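(* If either $q\ge 42$ and $q$ is even, or $q\in\{16,17,\dots,40\}$, then $\operatorname{achr}(K_6\square K_q)=2q+4$.
   Context: For a finite simple graph $G$, $\operatorname{achr}(G)$ (the achromatic number) is the maximum number of colours in a proper vertex colouring of $G$ that is complete, i.e. every pair of distinct colours appears on the two ends of some edge. $K_6\square K_q$ is the Cartesian product of the complete graphs $K_6$ and $K_q$ (vertex set $[1,6]\times[1,q]$, two vertices adjacent iff they agree in exactly one coordinate). *)

(* Defs.v *)
From mathcomp Require Import all_boot.
Set Implicit Arguments.
Unset Strict Implicit.
Unset Printing Implicit Defensive.

Record sgraph := SGraph {
  vert : finType;
  adj : rel vert;
  adj_sym : symmetric adj;
  adj_irr : irreflexive adj }.

Section Colouring.
Variable G : sgraph.

Definition proper_colouring (k : nat) (f : {ffun vert G -> 'I_k}) : bool :=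
  [forall x, forall y, adj x y ==> (f x != f y)].

Definition complete_colouring (k : nat) (f : {ffun vert G -> 'I_k}) : bool :=
  [forall c1 : 'I_k, forall c2 : 'I_k, (c1 != c2) ==>
     [exists x, exists y, [&& adj x y, f x == c1 & f y == c2]]].

Definition uses_all_colours (k : nat) (f : {ffun vert G -> 'I_k}) : bool :=
  [forall c : 'I_k, exists x, f x == c].

Definition achromatic_colourable (k : nat) : bool :=
  [exists f : {ffun vert G -> 'I_k},
     [&& proper_colouring f, complete_colouring f & uses_all_colours f]].

(* The range k <= #|V(G)| loses nothing: see [achromatic_colourable_card]. *)
Definition achr : nat :=
  \max_(k < #|vert G|.+1 | achromatic_colourable k) k.

Lemma achromatic_colourable_card (k : nat) :
  achromatic_colourable k -> k <= #|vert G|.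
Proof.
case/existsP=> f /and3P[_ _ /forallP fK].
rewrite -[k in k <= _]card_ord -(card_codom (f := id : 'I_k -> 'I_k)) //.
apply: leq_trans (leq_image_card f _); apply/subset_leq_card/subsetP=> c _.
by have /existsP[x /eqP<-] := fK c; apply: codom_f.
Qed.

Lemma achr_ge (k : nat) : achromatic_colourable k -> k <= achr.
Proof.
move=> kP; have kG := achromatic_colourable_card kP.
exact: (leq_bigmax_cond (Ordinal (kG : k < #|vert G|.+1))).
Qed.

End Colouring.

Section CompleteGraph.
Variable n : nat.

Definition complete_adj : rel 'I_n := fun i j => i != j.

Lemma complete_adj_sym : symmetric complete_adj.
Proof. by move=> i j; rewrite /complete_adj eq_sym. Qed.

Lemma complete_adj_irr : irreflexive complete_adj.
Proof. by move=> i; rewrite /complete_adj eqxx. Qed.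

Definition complete_graph : sgraph := SGraph complete_adj_sym complete_adj_irr.

End CompleteGraph.

Section CartesianProduct.
Variables G H : sgraph.

Definition cart_adj : rel (vert G * vert H) := fun u v =>
  (u.1 == v.1) && adj u.2 v.2 || adj u.1 v.1 && (u.2 == v.2).

Lemma cart_adj_sym : symmetric cart_adj.
Proof.
move=> u v; rewrite /cart_adj (eq_sym u.1) (eq_sym u.2).
by rewrite (adj_sym u.1) (adj_sym u.2).
Qed.

Lemma cart_adj_irr : irreflexive cart_adj.
Proof. by move=> u; rewrite /cart_adj !adj_irr andbF. Qed.

Definition cart_prod : sgraph := SGraph cart_adj_sym cart_adj_irr.

End CartesianProduct.

Lemma cart_prod_completeE (m n : nat)
    (u v : vert (cart_prod (complete_graph m) (complete_graph n))) :
  adj u v = (u.1 == v.1) (+) (u.2 == v.2).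
Proof.
by rewrite /= /cart_adj /= /complete_adj; case: (u.1 == v.1); case: (u.2 == v.2).
Qed.

(* Main.v *)
(* A colouring is a 6 x q matrix, and a colour lives on the set R of rows that contain
   it.  Two colours that share no row must share a column.

   Upper bound.  Suppose that there are k >= 2q + 5 colours.  Counting cells gives at
   least 15 colours with exactly two cells.  A colour on the rows e = {a, b} has only 8
   cells of its two columns outside e, and these contain every colour that avoids e;
   hence at most 8 colours avoid e and at most 3 colours cover e.  So the graph of the
   row pairs of two-cell colours is triangle-free of maximal degree 3, and a look at
   the pairs that carry three colours shows that it is K33 or K33 minus an edge, with
   one or two colours per edge.  Let T and T' be its sides.  All but few colours live
   exactly on T or exactly on T', and at most 9 on each, since a T-colour meets every
   T'-colour in one of the 9 cells of its columns.  This leaves q <= 18, and then the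
   two-cell colours have to fill at least 7 columns.  On the other hand, a column with
   a two-cell colour is either full of two-cell colours on a perfect matching or wastes
   some of the 8 cells above; adding up the waste over the columns (with weights found
   by linear programming) contradicts the number of cells that can be wasted.

   Lower bound.  Twelve two-cell colours fill four columns so that every set of three
   rows which picks one row of each of the pairs {0,1}, {2,3}, {4,5} meets all of them.
   The remaining columns are filled with colours on such sets: for even q four sets that
   pairwise intersect suffice, and for odd q <= 39 complementary sets are used, with at
   most 9 colours each, arranged in at most four blocks of columns. *)

Require Import Defs.
From mathcomp Require Import all_boot zify.
Set Implicit Arguments.
Unset Strict Implicit.
Unset Printing Implicit Defensive.

(** * Row sets of the colours of a matrix *)

Notation rowset := (seq bool).

Definition weight (s : rowset) := count id s.
Definition has_row (s : rowset) (i : nat) : bool := nth false s i.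
Fixpoint disj (s t : rowset) : bool :=
  match s, t with
  | a :: s', b :: t' => if a && b then false else disj s' t'
  | _, _ => true
  end.
Definition pair_rows (a b : nat) : rowset := mkseq (fun i => (i == a) || (i == b)) 6.

Arguments weight : simpl never.
Arguments has_row : simpl never.
Arguments pair_rows : simpl never.

Fixpoint all_rowsets (n : nat) : seq rowset :=
  if n is n'.+1 then [seq b :: s | b <- [:: true; false], s <- all_rowsets n']
  else [:: [::]].

Lemma mem_all_rowsets n s : size s = n -> s \in all_rowsets n.
Proof.
elim: n s => [|n IHn] [|b s] // [/IHn sn].
by apply: (@allpairs_f _ _ _ (fun (b : bool) s => b :: s)) => //; case: b.
Qed.

Lemma disjP s t : reflect (forall i, has_row s i -> has_row t i -> False) (disj s t).
Proof.
elim: s t => [|a s IHs] [|b t] /=;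
  try by left=> i; rewrite /has_row ?nth_nil // => _; rewrite nth_nil.
case: ifP => ab.
  by right=> /(_ 0); rewrite /has_row /=; case/andP: ab => -> -> /(_ isT isT).
apply: (iffP (IHs t)) => h i; last exact: h i.+1.
case: i => [|i]; last exact: h i.
by rewrite /has_row /= => a1 b1; rewrite a1 b1 in ab.
Qed.

Lemma disjPn s t : reflect (exists2 i, has_row s i & has_row t i) (~~ disj s t).
Proof.
apply: (iffP idP) => [|[i si ti]]; last by apply/negP => /disjP/(_ i si ti).
elim: s t => [|a s IHs] [|b t] //=; case: ifP => [/andP[a1 b1] _|_ /IHs[i si ti]].
  by exists 0; rewrite /has_row /= ?a1 ?b1.
by exists i.+1.
Qed.
Arguments disj : simpl never.

Lemma weightE s : size s = 6 -> weight s = \sum_(i < 6) has_row s i.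
Proof.
move=> s6; rewrite /weight -sum1_count big_mkcond (big_nth false) s6 big_mkord.
by apply: eq_bigr => i _; rewrite /has_row; case: nth.
Qed.

Lemma leq_sum_term (I : finType) (F : I -> nat) i : F i <= \sum_j F j.
Proof. by rewrite (bigD1 i) //= leq_addr. Qed.

(** * Double counting in an achromatic matrix *)

Section Matrix.
Variables (q k : nat) (M : nat -> 'I_q -> 'I_k).

Definition achromatic_matrix : Prop :=
  [/\ forall i j j', i < 6 -> M i j = M i j' -> j = j',
      forall i i' j, i < 6 -> i' < 6 -> M i j = M i' j -> i = i' &
      forall c c', c != c' -> exists i i' j j',
        [/\ i < 6, i' < 6, M i j = c, M i' j' = c' & i = i' \/ j = j']].

Definition rows (c : 'I_k) : rowset := mkseq (fun i => [exists j, M i j == c]) 6.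
Definition total (g : rowset -> nat) : nat := \sum_(c < k) g (rows c).

Arguments rows : simpl never.
Arguments total : simpl never.

Lemma size_rows c : size (rows c) = 6. Proof. by rewrite size_mkseq. Qed.

Lemma has_rowP c i : i < 6 -> reflect (exists j, M i j = c) (has_row (rows c) i).
Proof.
by move=> i6; rewrite /has_row nth_mkseq //; apply: (iffP existsP) => -[j /eqP];
  exists j => //; apply/eqP.
Qed.

Lemma has_row_cell i j : i < 6 -> has_row (rows (M i j)) i.
Proof. by move=> i6; apply/has_rowP => //; exists j. Qed.

Lemma eq_tot g1 g2 : (forall c, g1 (rows c) = g2 (rows c)) -> total g1 = total g2.
Proof. by move=> h; apply: eq_bigr => c _; apply: h. Qed.

Lemma totD g1 g2 : total (fun s => g1 s + g2 s) = total g1 + total g2.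
Proof. exact: big_split. Qed.

Lemma totMl n g : total (fun s => n * g s) = n * total g.
Proof. by rewrite /total big_distrr. Qed.

Lemma tot1 : total (fun=> 1) = k.
Proof. by rewrite /total sum1_card card_ord. Qed.

Lemma tot_sumn (I : Type) (l : seq I) (g : I -> rowset -> nat) :
  total (fun s => sumn [seq g x s | x <- l]) = sumn [seq total (g x) | x <- l].
Proof.
elim: l => [|x l IHl] /=; first by rewrite /total big1.
by rewrite -IHl -totD.
Qed.

Lemma leq_tot (ok : pred rowset) g1 g2 : (forall c, ok (rows c)) ->
  all (fun s => ok s ==> (g1 s <= g2 s)) (all_rowsets 6) -> total g1 <= total g2.
Proof.
move=> okM /allP h; apply: leq_sum => c _.
by have := h _ (mem_all_rowsets (size_rows c)); rewrite okM.
Qed.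

Lemma tot_gt0 (P : pred rowset) : 0 < total P -> exists c, P (rows c).
Proof.
case: (pickP (fun c => P (rows c))) => [c Pc _|P0]; first by exists c.
by rewrite /total big1 // => c _; rewrite P0.
Qed.

Hypothesis MP : achromatic_matrix.

Lemma row_card i c : i < 6 -> \sum_(j < q) (M i j == c) = has_row (rows c) i.
Proof.
case: MP => inj _ _ i6; case: has_rowP => // [[j <-]|nj].
  rewrite (bigD1 j) //= eqxx big1 // => j' /eqP jj'.
  by case: eqP => // /(inj _ _ _ i6).
by rewrite big1 // => j _; case: eqP => // e; case: nj; exists j.
Qed.

Lemma row_sum i (g : 'I_k -> nat) : i < 6 ->
  \sum_(j < q) g (M i j) = \sum_(c < k) has_row (rows c) i * g c.
Proof.
move=> i6; under eq_bigr => j _.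
  rewrite [g _](_ : _ = \sum_(c < k) (M i j == c) * g c); last first.
    rewrite (bigD1 (M i j)) //= eqxx mul1n big1 ?addn0 // => c.
    by rewrite eq_sym => /negbTE ->.
  over.
by rewrite exchange_big /=; apply: eq_bigr => c _; rewrite -big_distrl /= row_card.
Qed.

Lemma tot_row i : i < 6 -> total (fun s => has_row s i) = q.
Proof.
move=> i6; have := row_sum (fun=> 1) i6; rewrite sum1_card card_ord => ->.
by apply: eq_bigr => c _; rewrite muln1.
Qed.

Lemma col_card j c : \sum_(i < 6) (M i j == c) <= 1.
Proof.
case: MP => _ inj _; case: (pickP (fun i : 'I_6 => M i j == c)) => [i /eqP ic|h].
  rewrite (bigD1 i) //= ic eqxx big1 // => i' /eqP ii'.
  case: eqP => // i'c; have := inj i' i j (ltn_ord _) (ltn_ord _).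
  by rewrite i'c ic => /(_ erefl)/val_inj.
by rewrite big1 // => i _; rewrite h.
Qed.

Lemma cells_card c : \sum_(j < q) \sum_(i < 6) (M i j == c) = weight (rows c).
Proof.
rewrite exchange_big weightE ?size_rows //.
by apply: eq_bigr => i _; rewrite row_card.
Qed.

Lemma tot_weight : total weight = 6 * q.
Proof.
rewrite /total; under eq_bigr do rewrite weightE ?size_rows //.
rewrite exchange_big /=.
rewrite (eq_bigr (fun=> q)) => [|i _]; first by rewrite sum_nat_const card_ord.
exact: tot_row (ltn_ord i).
Qed.

Definition col_sum (c : 'I_k) (F : 'I_q -> nat) : nat :=
  \sum_(j < q) \sum_(i < 6) (M i j == c) * F j.

Lemma leq_col_sum c F G : (forall j, F j <= G j) -> col_sum c F <= col_sum c G.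
Proof. by move=> h; do 2!apply: leq_sum => ? _; apply: leq_mul. Qed.

Lemma col_sumD c F G : col_sum c (fun j => F j + G j) = col_sum c F + col_sum c G.
Proof.
rewrite /col_sum -big_split; apply: eq_bigr => j _; rewrite -big_split.
by apply: eq_bigr => i _; rewrite mulnDr.
Qed.

Lemma col_sum_const c n : col_sum c (fun=> n) = weight (rows c) * n.
Proof.
by rewrite -cells_card /col_sum big_distrl; apply: eq_bigr => j _; rewrite big_distrl.
Qed.

Lemma col_sum_ge (i : nat) j F : i < 6 -> F j <= col_sum (M i j) F.
Proof.
move=> i6; rewrite /col_sum (bigD1 j) // (bigD1 (Ordinal i6)) //= eqxx mul1n.
by rewrite -!addnA leq_addr.
Qed.

(** Every column of the colour other than [j] adds at most [n]; this is [col_sum_ge] for the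
    complement [n - F]. *)
Lemma col_sum_ge_slack i j F n : i < 6 -> (forall j', F j' <= n) ->
  col_sum (M i j) F + n <= weight (rows (M i j)) * n + F j.
Proof.
move=> i6 Fn; have := @col_sum_ge i j (fun j => n - F j) i6.
have : col_sum (M i j) F + col_sum (M i j) (fun j => n - F j) =
       weight (rows (M i j)) * n.
  rewrite -col_sumD -col_sum_const; apply: eq_bigr => j' _; apply: eq_bigr => i' _.
  by rewrite subnKC.
by have := Fn j; lia.
Qed.

Lemma meet_col c c' : c != c' -> disj (rows c) (rows c') ->
  exists (i i' : 'I_6) j, M i j = c /\ M i' j = c'.
Proof.
case: MP => _ _ h /h[i [i' [j [j' [i6 i'6 <- <- [ii'|<-]]]]]] dj.
  by case: (disjP _ _ dj i); rewrite ?has_row_cell // ii' has_row_cell.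
by exists (Ordinal i6), (Ordinal i'6), j.
Qed.

(** A colour in [P] shares no row with [c], so completeness puts it into a column of [c], where it
    is counted. [Q] records which cells it can occupy there. *)
Lemma tot_leq_col_sum_in c (P : pred rowset) (Q : nat -> 'I_q -> bool) :
  0 < weight (rows c) -> (forall s, P s -> disj (rows c) s) ->
  (forall i i' j, i < 6 -> i' < 6 -> M i j = c -> P (rows (M i' j)) -> Q i' j) ->
  total P <= col_sum c (fun j => \sum_(i < 6) (Q i j && P (rows (M i j)))).
Proof.
move=> c0 Pd PQ.
have -> : col_sum c (fun j => \sum_(i < 6) (Q i j && P (rows (M i j)))) =
    \sum_(c' < k) \sum_(j < q) \sum_(i < 6) \sum_(i' < 6)
      (M i j == c) * ((M i' j == c') * (Q i' j && P (rows c'))).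
  rewrite exchange_big; apply: eq_bigr => j _; rewrite exchange_big.
  apply: eq_bigr => i _; rewrite exchange_big /= big_distrr; apply: eq_bigr => i' _.
  rewrite -big_distrr /=; congr (_ * _); rewrite (bigD1 (M i' j)) //= eqxx mul1n.
  by rewrite big1 ?addn0 // => c'; rewrite eq_sym => /negbTE ->.
apply: leq_sum => c' _; case Pc: (P _) => //.
have cc' : c != c'.
  apply/eqP => ecc'; move: c0; rewrite weightE ?size_rows // big1 // => i _.
  case hi: has_row => //; case: (disjP _ _ (Pd _ Pc) i hi).
  by rewrite -ecc'.
have [i [i' [j [ic i'c]]]] := meet_col cc' (Pd _ Pc).
apply: leq_trans (leq_sum_term _ j); apply: leq_trans (leq_sum_term _ i).
apply: leq_trans (leq_sum_term _ i'); rewrite ic i'c !eqxx.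
by rewrite (PQ i i') ?i'c.
Qed.

Lemma tot_leq_col_sum c (P : pred rowset) :
  0 < weight (rows c) -> (forall s, P s -> disj (rows c) s) ->
  total P <= col_sum c (fun j => \sum_(i < 6) P (rows (M i j))).
Proof. by move=> c0 Pd; apply: (@tot_leq_col_sum_in c P (fun _ _ => true)). Qed.

(** The waste of a column: cells off the rows of [e] whose colour shares a row with [e] anyway, so
    that they do not help a colour on [e] to meet the colours avoiding it. *)
Definition col_bad (e : rowset) (j : 'I_q) : nat :=
  \sum_(i < 6) (~~ has_row e i && ~~ disj e (rows (M i j))).

(* The columns of [c] have [weight * (6 - weight)] cells outside the rows of [c];
   they contain every colour that shares no row with [c]. *)
Lemma disj_bad_bound c : 0 < weight (rows c) ->
  total (disj (rows c)) + col_sum c (col_bad (rows c)) <=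
  weight (rows c) * (6 - weight (rows c)).
Proof.
move=> c0; have h := tot_leq_col_sum c0 (fun s => id).
apply: leq_trans (leq_add h (leqnn _)) _.
rewrite -col_sumD -col_sum_const; apply: leq_col_sum => j.
rewrite -big_split /=.
apply: leq_trans (_ : \sum_(i < 6) (~~ has_row (rows c) i) <= _).
  apply: leq_sum => i _; case dj: (disj _ _) => /=; last by rewrite andbT.
  case hi: (has_row _ _) => //=.
  by case: (disjP _ _ dj i hi); apply: has_row_cell.
rewrite weightE ?size_rows //.
have : \sum_(i < 6) has_row (rows c) i + \sum_(i < 6) ~~ has_row (rows c) i = 6.
  rewrite -big_split /= -[RHS]card_ord -sum1_card; apply: eq_bigr => i _.
  by case: has_row.
by lia.
Qed.

End Matrix.

Arguments rows : simpl never.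
Arguments total : simpl never.

(** * More than 2q + 4 colours *)

Definition row_pairs : seq (nat * nat) :=
  [seq (a, b) | a <- iota 0 6, b <- iota a.+1 (5 - a)].

Definition covers (a b : nat) (s : rowset) : bool := has_row s a && has_row s b.
Definition avoids (a b : nat) (s : rowset) : bool := ~~ has_row s a && ~~ has_row s b.

Lemma pairC a b : pair_rows a b = pair_rows b a.
Proof. by apply: eq_mkseq => i; rewrite orbC. Qed.

Lemma row_pairs_lt a b : (a, b) \in row_pairs -> a < b < 6.
Proof.
by move/(allP (_ : all (fun x => x.1 < x.2 < 6) row_pairs)); apply.
Qed.

Lemma disj_pair a b s : a < 6 -> b < 6 -> disj (pair_rows a b) s = avoids a b s.
Proof.
move=> a6 b6; apply/disjP/andP => [h|[sa sb] i].
  by split; apply/negP; apply: h => //; rewrite /has_row nth_mkseq // eqxx ?orbT.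
case: (ltnP i 6) => i6; last by rewrite /has_row nth_default ?size_mkseq.
by rewrite /has_row nth_mkseq // => /orP[] /eqP ->; apply/negP.
Qed.

Lemma weight_pair a b : a < 6 -> b < 6 -> a != b -> weight (pair_rows a b) = 2.
Proof. by do 6?[case: a => [|a] //]; do 6?[case: b => [|b] //]. Qed.

Section Large.
Variables (q k : nat) (M : nat -> 'I_q -> 'I_k).
Hypothesis MP : achromatic_matrix M.
Hypotheses (q16 : 16 <= q) (kq : 2 * q + 5 <= k).

Local Notation tot := (total M).
Local Notation rows := (rows M).

Definition mult (a b : nat) : nat := tot (fun s => s == pair_rows a b).

Lemma multC a b : mult a b = mult b a. Proof. by rewrite /mult pairC. Qed.

Lemma mult_gt0 a b : 0 < mult a b -> exists c, rows c = pair_rows a b.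
Proof. by case/(@tot_gt0 _ _ M (fun s => s == pair_rows a b)) => c /eqP; exists c. Qed.

Lemma leq_disj_weight e : size e = 6 -> k <= tot (disj e) + weight e * q.
Proof.
move=> e6; apply: leq_trans (eq_leq (esym (tot1 M))) _; rewrite weightE // big_distrl /=.
rewrite (eq_bigr (fun i : 'I_6 => tot (fun s => has_row e i * has_row s i))) => [|i _];
  last by rewrite totMl tot_row.
rewrite /total exchange_big /= -big_split /=; apply: leq_sum => c _.
case: (boolP (disj _ _)) => //= /disjPn[i ei ci].
have i6 : i < 6 by rewrite -e6 ltnNge; apply: contraTN ei => h; rewrite /has_row nth_default.
rewrite add0n; apply: leq_trans (leq_sum_term _ (Ordinal i6)).
by rewrite /= ei ci.
Qed.

(** A colour with a single cell sees at most 5 colours outside its row and at most [q] inside, and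
    [q + 5 < k]. A colour without cells could not meet a second colour. *)
Lemma weight_rows_ge2 c : 2 <= weight (rows c).
Proof.
have w0 : 0 < weight (rows c).
  have [c' cc'] : exists c' : 'I_k, c != c'.
    have k1 : 0 < k by lia. have k2 : 1 < k by lia.
    case: (eqVneq c (Ordinal k1)) => [->|?]; last by exists (Ordinal k1).
    by exists (Ordinal k2).
  case: MP => _ _ /(_ _ _ cc')[i [i' [j [j' [i6 _ <- _ _]]]]].
  rewrite weightE ?size_rows //.
  by apply: leq_trans (leq_sum_term _ (Ordinal i6)); rewrite /= has_row_cell.
have := leq_disj_weight (size_rows M c); have := disj_bad_bound MP w0.
case: (weight _) w0 => [|[|w]] //= _; lia.
Qed.

Lemma covers_avoids a b : a < 6 -> b < 6 -> a != b ->
  tot (covers a b) + k = tot (avoids a b) + 2 * q.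
Proof.
move=> a6 b6 ab; have k1 := tot1 M; have qa := tot_row MP a6.
have qb := tot_row MP b6.
have : tot (fun s => covers a b s + 1) =
       tot (fun s => avoids a b s + (has_row s a + has_row s b)).
  by apply: eq_tot => c; rewrite /covers /avoids; do 2!case: has_row.
by rewrite !totD; lia.
Qed.

Lemma avoids_le8 a b : a < 6 -> b < 6 -> a != b -> 0 < mult a b ->
  tot (avoids a b) <= 8.
Proof.
move=> a6 b6 ab /mult_gt0[c rc].
have := @disj_bad_bound _ _ _ MP c; rewrite rc weight_pair // => /(_ erefl).
apply: leq_trans; apply: leq_trans (leq_addr _ _).
by rewrite (eq_tot (g2 := disj (pair_rows a b))) // => d; rewrite disj_pair.
Qed.

Lemma covers_le3 a b : a < 6 -> b < 6 -> a != b -> 0 < mult a b ->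
  tot (covers a b) <= 3.
Proof.
by move=> a6 b6 ab m0; have := covers_avoids a6 b6 ab; have := avoids_le8 a6 b6 ab m0; lia.
Qed.

Lemma mult_le_covers a b : a < 6 -> b < 6 -> mult a b <= tot (covers a b).
Proof.
move=> a6 b6; apply: leq_sum => c _; case: eqP => //= ->.
by rewrite /covers /has_row !nth_mkseq // !eqxx orbT.
Qed.

Lemma mult_le3 a b : a < 6 -> b < 6 -> a != b -> mult a b <= 3.
Proof.
move=> a6 b6 ab; case: (posnP (mult a b)) => [->//|m0].
exact: leq_trans (mult_le_covers a6 b6) (covers_le3 a6 b6 ab m0).
Qed.

(** Of three rows every row set contains two or misses two, so each colour covers or avoids one of
    the three pairs. This gives [k <= 3 * (3 + 8) = 33 < 37]. *)
Lemma no_triangle a b c : a < 6 -> b < 6 -> c < 6 ->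
  a != b -> a != c -> b != c ->
  0 < mult a b -> 0 < mult a c -> 0 < mult b c -> False.
Proof.
move=> a6 b6 c6 ab ac bc mab mac mbc.
have : k <= tot (covers a b) + tot (avoids a b) + (tot (covers a c) + tot (avoids a c))
            + (tot (covers b c) + tot (avoids b c)).
  rewrite -!totD; apply: leq_trans (eq_leq (esym (tot1 M))) _; apply: leq_sum => d _.
  by rewrite /covers /avoids; do 3!case: has_row.
have := covers_le3 a6 b6 ab mab; have := covers_le3 a6 c6 ac mac.
have := covers_le3 b6 c6 bc mbc; have := avoids_le8 a6 b6 ab mab.
by have := avoids_le8 a6 c6 ac mac; have := avoids_le8 b6 c6 bc mbc; lia.
Qed.

(** Apart from [a], at most one row [z] lies outside [v]. A set through [a] with a second row can
    miss [v] only if it is [{a, z}], which the last condition excludes. *)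
Lemma degree_check :
  all (fun a => all (fun v => all (fun s =>
    [&& 2 <= weight s, has_row s a, 4 <= weight v, ~~ has_row v a &
        all (fun z => (z != a) && (s == pair_rows a z) ==> has_row v z) (iota 0 6)] ==>
    has (fun x => has_row v x && has_row s x) (iota 0 6))
  (all_rowsets 6)) (all_rowsets 6)) (iota 0 6).
Proof. by vm_compute. Qed.

(** With four neighbours of [a], each of the [q] colours in row [a] would cover a pair [{a, x}] with
    [x] a neighbour. At most five such pairs with at most three colours each give [q <= 15]. *)
Lemma degree_le3 a : a < 6 ->
  weight (mkseq (fun x => (x != a) && (0 < mult a x)) 6) <= 3.
Proof.
move=> a6; rewrite leqNgt; apply/negP; set v := mkseq _ _ => v4.
have vE x : x < 6 -> has_row v x = (x != a) && (0 < mult a x).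
  by move=> x6; rewrite /has_row nth_mkseq.
have : q <= \sum_(x < 6) has_row v x * tot (covers a x).
  apply: leq_trans (eq_leq (esym (tot_row MP a6))) _.
  rewrite (eq_bigr (fun x : 'I_6 => tot (fun s => has_row v x * covers a x s))) => [|x _];
    last by rewrite totMl.
  rewrite /total exchange_big; apply: leq_sum => c _.
  case ca: (has_row (rows c) a) => //.
  have hs : all (fun z => (z != a) && (rows c == pair_rows a z) ==> has_row v z) (iota 0 6).
    apply/allP => z; rewrite mem_iota => /= z6; apply/implyP => /andP[za /eqP rc].
    by rewrite vE // za; apply: leq_trans (leq_sum_term _ c); rewrite /= rc eqxx.
  have/allP/(_ a) := degree_check; rewrite mem_iota => /(_ a6)/allP.
  move/(_ v (mem_all_rowsets (size_mkseq _ _)))/allP.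
  move/(_ _ (mem_all_rowsets (size_rows M c)))/implyP; rewrite ca v4 weight_rows_ge2.
  rewrite vE // eqxx hs => /(_ isT)/hasP[x].
  rewrite mem_iota => /= x6 /andP[vx cx].
  by apply: leq_trans (leq_sum_term _ (Ordinal x6)); rewrite /= vx /covers ca cx.
have : \sum_(x < 6) has_row v x * tot (covers a x) <= \sum_(x < 6) has_row v x * 3.
  apply: leq_sum => x _; rewrite vE //; case: eqVneq => //= xa.
  by case: posnP => // m0; rewrite !mul1n covers_le3 // eq_sym.
have : weight v <= 5.
  rewrite weightE ?size_mkseq // (bigD1 (Ordinal a6)) //= vE // eqxx add0n.
  apply: leq_trans (_ : \sum_(i < 6 | i != Ordinal a6) 1 <= _).
    by apply: leq_sum => i _; case: has_row.
  by rewrite sum1_card cardC1 card_ord.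
by rewrite -big_distrl /= -weightE ?size_mkseq //; lia.
Qed.

Lemma two_colours_ge15 : 15 <= tot (fun s => weight s == 2).
Proof.
have := tot_weight MP; have : 3 * k <= tot (fun s => weight s + (weight s == 2)).
  have -> : 3 * k = tot (fun=> 3 * 1) by rewrite totMl tot1.
  apply: leq_sum => c _.
  by have := weight_rows_ge2 c; case: (weight _) => [|[|[|w]]].
by rewrite totD; lia.
Qed.

(* All three colours on [f] occupy cells in the two rows of [f] and the two columns
   of a colour [A] on [e].  They have no spare neighbour, which forces every
   two-cell colour that shares one row with [f] and none with [e] into the
   fourth of these cells. *)
Lemma triple_pair_bound a b c d : a < 6 -> b < 6 -> c < 6 -> d < 6 ->
  a != b -> c != d -> disj (pair_rows c d) (pair_rows a b) ->
  3 <= mult a b -> 0 < mult c d ->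
  tot (fun s => [&& weight s == 2, disj (pair_rows c d) s, ~~ disj (pair_rows a b) s &
                    s != pair_rows a b]) <= 1.
Proof.
move=> a6 b6 c6 d6 ab cd; set e := pair_rows c d; set f := pair_rows a b.
pose G s := [&& weight s == 2, disj e s, ~~ disj f s & s != f].
move=> ef m3 m0; change (tot (fun s => G s) <= 1); have mf : 0 < mult a b by lia.
have [A rA] := mult_gt0 m0.
have wA : weight (rows A) = 2 by rewrite rA weight_pair.
have wf : weight f = 2 by rewrite weight_pair.
(* Three colours cover [f], so [covers_avoids] yields at least 8 colours avoiding [f]. They need all
   8 cells, and nothing is wasted. *)
have clean i j : i < 6 -> rows (M i j) = f -> col_bad M f j = 0.
  move=> i6 rf; have := @disj_bad_bound _ _ _ MP (M i j); rewrite rf wf => /(_ erefl).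
  have := @col_sum_ge _ _ M i j (col_bad M f) i6.
  rewrite (eq_tot (g2 := avoids a b)) => [|x]; last by rewrite disj_pair.
  by have := covers_avoids a6 b6 ab; have := mult_le_covers a6 b6; lia.
have frow i j : i < 6 -> rows (M i j) = f -> has_row f i.
  by move=> i6 <-; apply: has_row_cell.
have f2 (P : nat -> bool) : \sum_(i < 6) (has_row f i && P i) <= 2.
  apply: leq_trans (eq_leq wf); rewrite weightE ?size_mkseq //; apply: leq_sum => i _.
  by case: has_row; case: P.
(* A [G]-colour off the rows of [f] would be waste for any [f]-colour in the same column. All
   [f]-colours would then lie in the other column of [A], which has only two cells in the rows of
   [f]. *)
have Gf i i' j : i < 6 -> i' < 6 -> M i j = A -> G (rows (M i' j)) -> has_row f i'.
  move=> i6 i'6 ijA /and4P[_ _ Gf _]; apply/negPn/negP => fi'.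
  have := @tot_leq_col_sum_in _ _ _ MP A (fun s => s == f)
    (fun i0 j0 => (j0 != j) && has_row f i0).
  rewrite wA => /(_ erefl) h; have : mult a b <= 2; last by lia.
  apply: leq_trans (h _ _) _ => [s /eqP ->|i0 i1 j1 i06 i16 _ /eqP rf|].
  - by rewrite rA.
  - rewrite (frow i1 j1) // andbT; apply/eqP => jj.
    have := clean _ _ i16 rf; apply/eqP; rewrite -lt0n jj.
    by apply: leq_trans (leq_sum_term _ (Ordinal i'6)); rewrite /= fi' Gf.
  have := @col_sum_ge_slack _ _ _ MP i j
    (fun j0 => \sum_(i0 < 6) ((j0 != j) && has_row f i0 && (rows (M i0 j0) == f))) 2 i6.
  have F2 j0 : \sum_(i0 < 6) ((j0 != j) && has_row f i0 && (rows (M i0 j0) == f)) <= 2.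
    apply: leq_trans (f2 (fun i0 => rows (M i0 j0) == f)).
    by apply: leq_sum => i0 _; case: (_ != _).
  move/(_ F2); rewrite ijA wA [X in _ <= _ + X]big1 => [|i0 _]; last by rewrite eqxx.
  by lia.
have : tot (fun s => (s == f) || G s) <= 4.
  have := @tot_leq_col_sum_in _ _ _ MP A (fun s => (s == f) || G s)
    (fun i0 _ => has_row f i0).
  rewrite wA => /(_ erefl) h; apply: leq_trans (h _ _) _.
  - by move=> s /orP[/eqP->|/and4P[]]; rewrite rA.
  - by move=> i i' j i6 i'6 ijA /orP[/eqP /(frow _ _ i'6)//|]; apply: Gf ijA.
  apply: leq_trans (_ : _ <= col_sum M A (fun=> 2)) _; last by rewrite col_sum_const ?wA.
  by apply: leq_col_sum => j; apply: (f2 (fun i => (rows (M i j) == f) || G (rows (M i j)))).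
have -> : tot (fun s => (s == f) || G s) = mult a b + tot (fun s => G s); last by lia.
rewrite -totD; apply: eq_tot => x; rewrite /G /=; case: eqP => //= _.
by rewrite !andbF.
Qed.

End Large.

(** * The multiplicities of the two-cell colours *)

(* [has] with lazy evaluation under [vm_compute]. *)
Fixpoint lazy_has (T : Type) (p : T -> bool) (s : seq T) : bool :=
  if s is x :: s' then (if p x then true else lazy_has p s') else false.

Lemma lazy_hasE (T : Type) (p : T -> bool) s : lazy_has p s = has p s.
Proof. by elim: s => //= x s ->; case: (p x). Qed.
Arguments lazy_has : simpl never.

(* The position of a pair of rows in [row_pairs]; the diagonal is out of range. *)
Definition pair_index : seq (seq nat) :=
  [:: [:: 15; 0; 1; 2; 3; 4]; [:: 0; 15; 5; 6; 7; 8]; [:: 1; 5; 15; 9; 10; 11];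
      [:: 2; 6; 9; 15; 12; 13]; [:: 3; 7; 10; 12; 15; 14]; [:: 4; 8; 11; 13; 14; 15]].

Definition entry (t : seq nat) (a b : nat) : nat :=
  nth 0 t (nth 0 (nth [::] pair_index a) b).

Definition has_triangle (t : seq nat) : bool :=
  lazy_has (fun ab => if 0 < entry t ab.1 ab.2 then
    lazy_has (fun c => if 0 < entry t ab.1 c then 0 < entry t ab.2 c else false)
      (iota 0 6) else false) row_pairs.

Definition has_degree4 (t : seq nat) : bool :=
  lazy_has (fun a => 4 <= weight (mkseq (fun x => 0 < entry t a x) 6)) (iota 0 6).

(** The colours limited by [triple_pair_bound]: one row in [{a, b}] and the other outside
    [{a, b, c, d}]. *)
Definition exclusive_sum (t : seq nat) (a b c d : nat) : nat :=
  sumn [seq entry t a y + entry t b y |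
        y <- iota 0 6 & y \notin [:: a; b; c; d]].
Arguments exclusive_sum : simpl never.

Definition has_heavy (t : seq nat) : bool :=
  lazy_has (fun ab => if 3 <= entry t ab.1 ab.2 then
    lazy_has (fun cd => if 0 < entry t cd.1 cd.2 then
      if disj (pair_rows cd.1 cd.2) (pair_rows ab.1 ab.2) then
        1 < exclusive_sum t ab.1 ab.2 cd.1 cd.2
      else false else false) row_pairs else false) row_pairs.

Definition excluded (t : seq nat) : bool :=
  if has_triangle t then true else if has_degree4 t then true else has_heavy t.

(* The nine entries belong to the pairs 03, 04, 05, 13, 14, 15, 23, 24, 25; the
   table lists all fifteen pairs in the order of [row_pairs]. *)
Definition k33_table (m : seq nat) : seq nat :=
  if m is [:: a; b; c; d; e; f; g; h; i]
  then [:: 0; 0; a; b; c; 0; d; e; f; g; h; i; 0; 0; 0] else [::].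

Definition k33_mults : seq (seq nat) :=
  [:: [:: 2; 2; 2; 2; 2; 2; 2; 2; 2]; [:: 1; 2; 2; 2; 2; 2; 2; 2; 2];
      [:: 1; 1; 2; 2; 2; 2; 2; 2; 2]; [:: 1; 2; 2; 2; 1; 2; 2; 2; 2];
      [:: 1; 1; 1; 2; 2; 2; 2; 2; 2]; [:: 1; 1; 2; 1; 2; 2; 2; 2; 2];
      [:: 1; 1; 2; 2; 2; 1; 2; 2; 2]; [:: 1; 2; 2; 2; 1; 2; 2; 2; 1]].

Definition k33_minus_mults : seq (seq nat) :=
  [:: [:: 2; 2; 2; 2; 2; 2; 2; 2; 0]; [:: 1; 2; 2; 2; 2; 2; 2; 2; 0];
      [:: 2; 2; 1; 2; 2; 2; 2; 2; 0]].

Definition permute (sg t : seq nat) : seq nat :=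
  [seq entry t (nth 0 sg ab.1) (nth 0 sg ab.2) | ab <- row_pairs].

Section Search.
Variables (mx lo : nat) (bad fin : pred (seq nat)).

(** Depth-first search that cuts a branch once the sum [lo] is out of reach. Entries not chosen yet
    read as 0, so [bad] can test a prefix; after a trailing 0 the test is skipped, since a 0 creates
    no new obstruction. *)
Fixpoint search (n : nat) (t : seq nat) : bool :=
  if sumn t + mx * n < lo then true else
  if (if last 0 t == 0 then false else bad t) then true else
  if n is n'.+1 then all (fun v => search n' (rcons t v)) (iota 0 mx.+1) else fin t.

Lemma searchP t s : search (size s) t -> all (fun v => v <= mx) s ->
  lo <= sumn (t ++ s) -> (forall n, ~~ bad (take n (t ++ s))) -> fin (t ++ s).
Proof.
elim: s t => [|v s IHs] t /=.
  rewrite cats0 muln0 addn0 => + _ lo_t nb; rewrite ltnNge lo_t.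
  by have := nb (size t); rewrite take_size => /negbTE ->; rewrite if_same.
move=> + /andP[vm sm] lo_t nb; rewrite ltnNge.
have -> : lo <= sumn t + mx * (size s).+1.
  apply: leq_trans lo_t _; rewrite sumn_cat /= leq_add2l mulnS leq_add //.
  by elim: s sm {IHs nb} => [|w s IHs] /=; rewrite ?muln0 // mulnS => /andP[? /IHs];
    apply: leq_add.
have := nb (size t); rewrite take_size_cat // => /negbTE ->; rewrite if_same /=.
case/andP=> h0 /allP h; rewrite -cat_rcons; apply: IHs => //; rewrite ?cat_rcons //.
by case: v vm {nb lo_t} => [|v] vm //; apply: h; rewrite mem_iota /=; lia.
Qed.

End Search.

Lemma no_heavy_search : search 3 15 excluded xpred0 14 [:: 3].
Proof. by vm_compute. Qed.

(** The ten splits of the rows into two triples, each as a permutation that lists the triple of row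
    0 first. *)
Definition splits : seq (seq nat) :=
  [seq let T := [:: 0; xy.1; xy.2] in T ++ [seq i <- iota 0 6 | i \notin T] |
   xy <- row_pairs & 0 < xy.1].

Definition bipartite (t : seq nat) : bool :=
  all (fun ab => entry t ab.1 ab.2 == 0)
    [:: (0, 1); (0, 2); (1, 2); (3, 4); (3, 5); (4, 5)].

(** Applied to the 0/1 support: a triangle-free graph on six vertices with at least eight edges and
    degrees at most 3 lies in K33. The degree bound rules out K24. *)
Lemma bipartite_search :
  search 1 8 excluded (fun t => has (fun sg => bipartite (permute sg t)) splits) 15 [::].
Proof. by vm_compute. Qed.

Definition k33_perms : seq (seq nat) :=
  [seq s ++ t | s <- permutations [:: 0; 1; 2], t <- permutations [:: 3; 4; 5]] ++
  [seq t ++ s | s <- permutations [:: 0; 1; 2], t <- permutations [:: 3; 4; 5]].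

(** Nine entries at most 2 with sum at least 15 fall short of 18 by at most 3. Permuting each side
    and exchanging the sides leaves eight cases without a zero and three with one zero. *)
Lemma canonical_search : search 2 15 xpred0 (fun m =>
  has (fun sg => permute sg (k33_table m) \in map k33_table (k33_mults ++ k33_minus_mults))
    k33_perms) 9 [::].
Proof. by vm_compute. Qed.

(** * Renumbering the rows *)

Section Permute.
Variables (q k : nat) (M : nat -> 'I_q -> 'I_k) (sg : seq nat).
Hypothesis sgP : perm_eq sg (iota 0 6).

Definition permute_rows : nat -> 'I_q -> 'I_k := fun i j => M (nth 0 sg i) j.

Let size_sg : size sg = 6. Proof. by rewrite (perm_size sgP) size_iota. Qed.

Let sg_lt i : i < 6 -> nth 0 sg i < 6.
Proof.
by move=> i6; have := mem_nth 0 (_ : i < size sg); rewrite size_sg => /(_ i6);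
  rewrite (perm_mem sgP) mem_iota.
Qed.

Let sg_inj i j : i < 6 -> j < 6 -> (nth 0 sg i == nth 0 sg j) = (i == j).
Proof.
by move=> i6 j6; rewrite nth_uniq ?size_sg // (perm_uniq sgP) iota_uniq.
Qed.

Let sg_surj i : i < 6 -> exists2 i', i' < 6 & nth 0 sg i' = i.
Proof.
move=> i6; have i_sg : i \in sg by rewrite (perm_mem sgP) mem_iota.
by exists (index i sg); [rewrite -size_sg index_mem | rewrite nth_index].
Qed.

Lemma permute_rowsP : achromatic_matrix M -> achromatic_matrix permute_rows.
Proof.
case=> inj1 inj2 cov; split.
- by move=> i j j' i6; apply: inj1; apply: sg_lt.
- move=> i i' j i6 i'6 /inj2 h; apply/eqP; rewrite -sg_inj //; apply/eqP/h; exact: sg_lt.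
move=> c c' /cov[i [i' [j [j' [/sg_surj[r r6 <-] /sg_surj[r' r'6 <-] ic i'c h]]]]].
exists r, r', j, j'; split => //; case: h => [/eqP|]; last by right.
by rewrite sg_inj // => /eqP; left.
Qed.

Lemma has_row_permute c i : i < 6 ->
  has_row (rows permute_rows c) i = has_row (rows M c) (nth 0 sg i).
Proof. by move=> i6; rewrite /has_row !nth_mkseq // sg_lt. Qed.

Lemma mult_permute a b : a < 6 -> b < 6 ->
  mult permute_rows a b = mult M (nth 0 sg a) (nth 0 sg b).
Proof.
move=> a6 b6; apply: eq_bigr => c _; congr nat_of_bool.
have pairE x y i : i < 6 -> has_row (pair_rows x y) i = (i == x) || (i == y).
  by move=> i6; rewrite /has_row nth_mkseq.
apply/eqP/eqP => h; apply: (@eq_from_nth _ false); rewrite ?size_rows ?size_mkseq // => i i6.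
  have [i' i'6 <-] := sg_surj i6; rewrite -[LHS]has_row_permute // h.
  by rewrite -[LHS]/(has_row _ _) -[RHS]/(has_row _ _) !pairE ?sg_lt // !sg_inj.
rewrite -[LHS]/(has_row _ _) -[RHS]/(has_row _ _) has_row_permute // h.
by rewrite !pairE ?sg_lt // !sg_inj.
Qed.

End Permute.

Definition table (q k : nat) (M : nat -> 'I_q -> 'I_k) : seq nat :=
  [seq mult M ab.1 ab.2 | ab <- row_pairs].

Lemma entry_map (g : nat -> nat -> nat) a b : (forall x y, g x y = g y x) ->
  a < 6 -> b < 6 -> a != b -> entry [seq g ab.1 ab.2 | ab <- row_pairs] a b = g a b.
Proof.
move=> gC; do 6?[case: a => [|a] //]; do 6?[case: b => [|b] //]; move=> _ _ _ //;
exact: gC.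
Qed.

Lemma table_permute q k (M : nat -> 'I_q -> 'I_k) sg : perm_eq sg (iota 0 6) ->
  table (permute_rows M sg) = permute sg (table M).
Proof.
move=> sgP; apply/eq_in_map => -[a b] /row_pairs_lt /andP[ab b6] /=.
have a6 := ltn_trans ab b6; have sz : size sg = 6 by rewrite (perm_size sgP).
have lt6 i : i < 6 -> nth 0 sg i < 6.
  move=> i6; have : nth 0 sg i \in sg by rewrite mem_nth ?sz.
  by rewrite (perm_mem sgP) mem_iota.
rewrite mult_permute // entry_map ?lt6 //; first exact: multC.
by rewrite nth_uniq ?sz ?(perm_uniq sgP) ?iota_uniq // neq_ltn ab.
Qed.

Lemma leq_sumn_map (T : eqType) (f g : T -> nat) l :
  (forall x, x \in l -> f x <= g x) -> sumn (map f l) <= sumn (map g l).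
Proof.
elim: l => //= x l IHl h; rewrite leq_add ?h ?mem_head // IHl // => y yl.
by rewrite h // inE yl orbT.
Qed.

(** For [y] off the four rows the pairs [{a, y}] and [{b, y}] are all distinct, so at most one of
    them is [s], and then [s] is one of the sets counted in [triple_pair_bound]. *)
Lemma heavy_check : all (fun ab => all (fun cd => all (fun s =>
  disj (pair_rows cd.1 cd.2) (pair_rows ab.1 ab.2) ==>
  (sumn [seq (s == pair_rows ab.1 y) + (s == pair_rows ab.2 y) |
         y <- iota 0 6 & y \notin [:: ab.1; ab.2; cd.1; cd.2]] <=
   [&& weight s == 2, disj (pair_rows cd.1 cd.2) s, ~~ disj (pair_rows ab.1 ab.2) s &
       s != pair_rows ab.1 ab.2])) (all_rowsets 6)) row_pairs) row_pairs.
Proof. by vm_compute. Qed.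

Section Table.
Variables (q k : nat) (M : nat -> 'I_q -> 'I_k).
Hypothesis MP : achromatic_matrix M.
Hypotheses (q16 : 16 <= q) (kq : 2 * q + 5 <= k).

Let size_table : size (table M) = 15. Proof. by rewrite size_map. Qed.

Lemma entry_table a b : a < 6 -> b < 6 -> a != b -> entry (table M) a b = mult M a b.
Proof. by apply: entry_map; apply: multC. Qed.

Lemma table_le3 : all (fun v => v <= 3) (table M).
Proof.
apply/allP => v /mapP[[a b] /row_pairs_lt /andP[ab b6] ->].
by apply: mult_le3 => //; rewrite ?(ltn_trans ab) // neq_ltn ab.
Qed.

Lemma sumn_table : 15 <= sumn (table M).
Proof.
have := two_colours_ge15 MP q16 kq; rewrite /table /mult -tot_sumn => /leq_trans; apply.
apply: (@leq_tot _ _ M predT) => //; by vm_compute.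
Qed.

Section Below.
Variable u : seq nat.
Hypothesis ut : forall i, nth 0 u i <= nth 0 (table M) i.

Let entry_le a b : a < 6 -> b < 6 -> a != b -> entry u a b <= mult M a b.
Proof. by move=> a6 b6 ab; rewrite -entry_table //; apply: ut. Qed.

Let entry_diag a : a < 6 -> entry u a a = 0.
Proof.
move=> a6; apply/eqP; rewrite -leqn0; apply: leq_trans (ut _) _.
by rewrite nth_default // size_table; do 6?[case: a a6 => [|a] a6 //].
Qed.

Let entry_gt0 a b : a < 6 -> b < 6 -> 0 < entry u a b -> a != b /\ 0 < mult M a b.
Proof.
move=> a6 b6; case: (eqVneq a b) => [->|ab]; first by rewrite entry_diag.
by move=> u0; split=> //; apply: leq_trans u0 (entry_le _ _ _).
Qed.

(** The obstructions only use lower bounds on entries, so they are refuted for every [u] below the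
    table. The searches need this for prefixes and for the 0/1 support. *)
Lemma not_excluded : ~~ excluded u.
Proof.
rewrite /excluded; case: ifP => [|_].
  rewrite /has_triangle lazy_hasE => /hasP[[a b] /row_pairs_lt /andP[ab b6] /=].
  have a6 := ltn_trans ab b6.
  case: ifP => // /(entry_gt0 a6 b6)[_ mab].
  rewrite lazy_hasE => /hasP[c]; rewrite -[c \in _]/(c \in iota 0 6) mem_iota => /= c6.
  case: ifP => // /(entry_gt0 a6 c6)[ac mac] /(entry_gt0 b6 c6)[bc mbc].
  by case: (no_triangle MP q16 kq a6 b6 c6 _ ac bc mab mac mbc); rewrite neq_ltn ab.
case: ifP => [|_].
  rewrite /has_degree4 lazy_hasE => /hasP[a]; rewrite mem_iota => /= a6 d4.
  have := degree_le3 MP q16 kq a6; rewrite leqNgt => /negP[]; apply: leq_trans d4 _.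
  rewrite !weightE ?size_mkseq //; apply: leq_sum => x _; rewrite /has_row !nth_mkseq //.
  case: posnP => // /(entry_gt0 a6 (ltn_ord x))[ax ->]; by rewrite eq_sym ax.
apply/negP; rewrite /has_heavy lazy_hasE => /hasP[[a b] abE /=].
have /andP[ab b6] := row_pairs_lt abE.
have a6 := ltn_trans ab b6; have nab : a != b by rewrite neq_ltn ab.
case: ifP => // u3.
rewrite lazy_hasE => /hasP[[c d] cdE /=]; have /andP[cd d6] := row_pairs_lt cdE.
have c6 := ltn_trans cd d6; have ncd : c != d by rewrite neq_ltn cd.
case: ifP => // /(entry_gt0 c6 d6)[_ mcd]; case: ifP => // dj.
have m3 := leq_trans u3 (entry_le a6 b6 nab).
have := triple_pair_bound MP q16 kq a6 b6 c6 d6 nab ncd dj m3 mcd.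
move=> h1; rewrite ltnNge => /negP[]; apply: leq_trans h1.
apply: (@leq_trans (sumn [seq mult M a y + mult M b y |
   y <- iota 0 6 & y \notin [:: a; b; c; d]])).
  apply: leq_sumn_map => y; rewrite mem_filter mem_iota !inE !negb_or.
  by case/andP=> /and4P[ya yb _ _] /= y6; rewrite leq_add ?entry_le // eq_sym.
rewrite [X in X <= _](_ : _ =
  total M (fun s => sumn [seq (s == pair_rows a y) + (s == pair_rows b y) |
   y <- iota 0 6 & y \notin [:: a; b; c; d]])); last first.
  by rewrite tot_sumn; congr sumn; apply: eq_map => y; rewrite totD.
apply: (@leq_tot _ _ M predT) => //; apply/allP => s s6.
by have/allP/(_ _ abE)/allP/(_ _ cdE)/allP/(_ _ s6)/implyP := heavy_check; apply.
Qed.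

End Below.
End Table.

Lemma nth_take_le (t : seq nat) n i : nth 0 (take n t) i <= nth 0 t i.
Proof.
case: (ltnP i n) => ni; first by rewrite nth_take.
by rewrite nth_default // size_take_min geq_min ni.
Qed.

(** Moving a pair with three colours to rows 0 and 1 makes the table begin with 3, which is where
    [no_heavy_search] starts. *)
Lemma table_le2 q k (M : nat -> 'I_q -> 'I_k) :
  achromatic_matrix M -> 16 <= q -> 2 * q + 5 <= k -> all (fun v => v <= 2) (table M).
Proof.
move=> MP q16 kq; apply/allP => v /mapP[[a b] abE ->] /=; rewrite leqNgt; apply/negP => v3.
have sgP : perm_eq ([:: a; b] ++ [seq i <- iota 0 6 | i \notin [:: a; b]]) (iota 0 6).
  exact: (allP (_ : all (fun ab => perm_eq ([:: ab.1; ab.2] ++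
    [seq i <- iota 0 6 | i \notin [:: ab.1; ab.2]]) (iota 0 6)) row_pairs) _ abE).
have M'P := permute_rowsP sgP MP; set sg := _ ++ _ in sgP M'P.
have e3 : mult (permute_rows M sg) 0 1 = 3.
  have /andP[ab b6] := row_pairs_lt abE.
  apply/eqP; rewrite mult_permute // eqn_leq v3 andbT.
  by apply: mult_le3 => //; rewrite ?(ltn_trans ab) // neq_ltn ab.
have tE : table (permute_rows M sg) = [:: 3] ++ behead (table (permute_rows M sg)).
  by rewrite -e3.
have := @searchP 3 15 excluded xpred0 [:: 3] (behead (table (permute_rows M sg))).
rewrite -tE size_behead size_map => /(_ no_heavy_search) h.
have : false; last by []; apply: h => [||n].
- by apply/allP => x /mem_behead /(allP (table_le3 M'P q16 kq)).
- exact: sumn_table.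
- by apply: (not_excluded M'P) => // i; apply: nth_take_le.
Qed.

Lemma entry_map0 (h : nat -> nat) t a b : h 0 = 0 -> entry (map h t) a b = h (entry t a b).
Proof.
move=> h0; rewrite /entry; set i := nth 0 (nth _ pair_index _) _.
case: (ltnP i (size t)) => it; first by rewrite (nth_map 0).
by rewrite !nth_default ?size_map.
Qed.

Lemma permute_map0 (h : nat -> nat) sg t : h 0 = 0 ->
  permute sg (map h t) = map h (permute sg t).
Proof. by move=> h0; rewrite -map_comp; apply: eq_map => ab /=; rewrite entry_map0. Qed.

Lemma canonical_form q k (M : nat -> 'I_q -> 'I_k) :
  achromatic_matrix M -> 16 <= q -> 2 * q + 5 <= k ->
  exists2 M' : nat -> 'I_q -> 'I_k, achromatic_matrix M' &
  exists2 m, m \in k33_mults ++ k33_minus_mults & table M' = k33_table m.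
Proof.
move=> MP q16 kq; pose pos n : nat := 0 < n.
have [sg sgP bip] : exists2 sg, perm_eq sg (iota 0 6) & bipartite (permute sg (table M)).
  (* With at most two colours on a pair, 15 two-cell colours occupy at least 8 pairs. *)
  have : has (fun sg => bipartite (permute sg (map pos (table M)))) splits.
    have := @searchP 1 8 excluded
      (fun t => has (fun sg => bipartite (permute sg t)) splits) [::] (map pos (table M)).
    rewrite !size_map => /(_ bipartite_search) h; apply: h => [||n].
    - by apply/allP => x /mapP[v _ ->]; rewrite /pos; case: (0 < v).
    - have := sumn_table MP q16 kq; have := table_le2 MP q16 kq; rewrite cat0s.
      have : forall t, all (fun v => v <= 2) t -> sumn t <= 2 * sumn (map pos t).
        by elim=> //= v t IHt /andP[v2 /IHt]; rewrite /pos; lia.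
      by move=> h2 /h2; lia.
    - apply: (not_excluded MP) => // i; apply: leq_trans (nth_take_le _ _ _) _.
      case: (ltnP i (size (table M))) => it; last by rewrite nth_default ?size_map.
      by rewrite (nth_map 0) // /pos; case: nth.
  case/hasP => sg sgS; rewrite permute_map0 // => bip; exists sg.
    exact: (allP (_ : all (fun sg => perm_eq sg (iota 0 6)) splits) _ sgS).
  apply: sub_all bip => ab; rewrite entry_map0 // /pos.
  by case: posnP => // ->.
set M1 := permute_rows M sg; have M1P : achromatic_matrix M1 by apply: permute_rowsP.
rewrite -table_permute // -/M1 in bip.
pose m := [seq nth 0 (table M1) i | i <- [:: 2; 3; 4; 6; 7; 8; 9; 10; 11]].
have tM1 : table M1 = k33_table m.
  have := bip; rewrite /bipartite /m; have : size (table M1) = 15 by rewrite size_map.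
  move: (table M1); do 15?[case=> // ?]; case=> // _; rewrite /entry /=.
  by move=> /and5P[/eqP-> /eqP-> /eqP-> /eqP-> /and3P[/eqP-> /eqP-> _]].
have := @searchP 2 15 xpred0 (fun m => has (fun sg => permute sg (k33_table m) \in
  map k33_table (k33_mults ++ k33_minus_mults)) k33_perms) [::] m.
rewrite size_map => /(_ canonical_search) h.
have {h} /hasP[sg2 sg2P] : has (fun sg => permute sg (k33_table m) \in
  map k33_table (k33_mults ++ k33_minus_mults)) k33_perms.
  apply: h => //.
    apply/allP => v /mapP[i _ ->]; case: (ltnP i (size (table M1))) => it.
      by apply/(allP (table_le2 M1P q16 kq))/mem_nth.
    by rewrite nth_default.
  by have := sumn_table M1P q16 kq; rewrite tM1 /=; lia.
have {}sg2P : perm_eq sg2 (iota 0 6).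
  exact: (allP (_ : all (fun sg => perm_eq sg (iota 0 6)) k33_perms) _ sg2P).
rewrite -tM1 -table_permute // => /mapP[m' m'P tE].
by exists (permute_rows M1 sg2); [apply: permute_rowsP | exists m'].
Qed.

(** * Column patterns *)

Definition k33_edges : seq (nat * nat) :=
  [:: (0, 3); (0, 4); (0, 5); (1, 3); (1, 4); (1, 5); (2, 3); (2, 4); (2, 5)].

Definition edge_rows (e : nat * nat) : rowset := pair_rows e.1 e.2.

(** The list [l] is indexed by [k33_edges]. Since [zip] truncates, a shorter list stands for one
    padded with zeros. *)
Definition weigh (l : seq nat) (s : rowset) : nat :=
  sumn [seq x.2 * (s == edge_rows x.1) | x <- zip k33_edges l].

Definition disj_mult (m : seq nat) (s : rowset) : nat :=
  sumn [seq x.2 * disj s (edge_rows x.1) | x <- zip k33_edges m].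

(** A pair [s] is avoided by at least [disj_mult m s] colours and, by [covers_avoids], by at least
    [weigh m s + 5]; the rest of the 8 cells may be wasted. *)
Definition slack (m : seq nat) (s : rowset) : nat :=
  minn (8 - disj_mult m s) (3 - weigh m s).

Arguments edge_rows : simpl never.
Arguments weigh : simpl never.
Arguments disj_mult : simpl never.

(* A pattern lists the row sets of the two-cell colours of a column; [[::]] stands
   for a cell with a colour of at least three cells. *)
Definition bad_cells (c : seq rowset) (e : rowset) : nat :=
  count (fun i => ~~ has_row e i && ~~ disj e (nth [::] c i)) (iota 0 6).

(** A partial column is refuted if it has more colours on a pair than exist, or more waste than the
    slack. Cells not filled yet read as [[::]], which is disjoint from every set and hence never
    waste. *)
Definition pruned (m : seq nat) (c : seq rowset) : bool :=
  if last [::] c == [::] then false else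
  lazy_has (fun e => if e == [::] then false else
    let b := bad_cells c e in if b == 0 then weigh m e < count_mem e c
    else if weigh m e < count_mem e c then true else slack m e < b) c.

(** The other column of a colour on [e] has only four cells off [e]; the remaining two-cell colours
    disjoint from [e] must appear in this column. *)
Definition crowded (m : seq nat) (c : seq rowset) : bool :=
  all (fun e => (e == [::]) ||
    (disj_mult m e <= 4 + count (fun s => (s != [::]) && disj e s) c)) c.

Definition hit_cost (cw : seq (rowset * nat)) (i : nat) (s : rowset) : nat :=
  sumn [seq x.2 * (~~ has_row x.1 i && ~~ disj x.1 s) | x <- cw].

Definition big_rowsets : seq rowset := [seq s <- all_rowsets 6 | 3 <= weight s].

(** An unknown colour with at least three cells is charged at the cheapest row set through row
    [i]. *)
Definition min_hit_cost (cw : seq (rowset * nat)) (i : nat) : nat :=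
  let l := [seq hit_cost cw i s | s <- big_rowsets & has_row s i] in
  foldr minn (head 0 l) l.

Definition min_cost (W : seq nat) (c : seq rowset) : nat :=
  let cw := [seq (e, weigh W e) | e <- c & e != [::]] in
  sumn [seq if nth [::] c i == [::] then min_hit_cost cw i
            else hit_cost cw i (nth [::] c i) | i <- iota 0 6].

(** Coefficients of a linear inequality for one column, in which [penalty] weighs the waste. Its sum
    over all columns is [cert_bound]. *)
Record cert := Cert { gain : seq nat; loss : seq nat; penalty : seq nat; base : nat }.

Definition cert_ok (x : cert) (c : seq rowset) : bool :=
  base x + sumn (map (weigh (loss x)) c) <=
  sumn (map (weigh (gain x)) c) + min_cost (penalty x) c.

Definition pattern_ok (m : seq nat) (xs : seq cert) (c : seq rowset) : bool :=
  if all (pred1 [::]) c then true else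
  if crowded m c then all (cert_ok^~ c) xs else true.

Definition cell_options (m : seq nat) (i : nat) : seq rowset :=
  [::] :: [seq edge_rows x.1 | x <- zip k33_edges m &
             (0 < x.2) && has_row (edge_rows x.1) i].

Fixpoint pattern_search (m : seq nat) (xs : seq cert) (opts : seq (seq rowset))
    (c : seq rowset) : bool :=
  if pruned m c then true else
  if opts is o :: opts' then all (fun s => pattern_search m xs opts' (rcons c s)) o
  else pattern_ok m xs c.

Definition certified (m : seq nat) (xs : seq cert) : bool :=
  pattern_search m xs (map (cell_options m) (iota 0 6)) [::].

(* The columns with a two-cell colour of K33 satisfy [r + (3/2) b >= 6], where [r]
   counts the two-cell colours and [b] the hits, weighted by [1 / multiplicity]. *)
Definition k33_cert (m : seq nat) : cert :=
  Cert (nseq 9 4) [::] [seq if v == 1 then 6 else 3 | v <- m] 24.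

(** Each column with the only colour on the first pair of multiplicity 1 has some waste. If no entry
    is 1, the coefficient 1 stands in tenth place and [zip] drops it. *)
Definition single_cert (m : seq nat) : cert :=
  Cert [::] (rcons (nseq (index 1 m) 0) 1) [seq if v == 1 then 2 else 1 | v <- m] 0.

Lemma k33_certified :
  all (fun m => certified m [:: k33_cert m; single_cert m]) k33_mults.
Proof. by vm_compute. Qed.

(** The missing edge is [{2, 5}]. Edges at its ends count double, because no bound is available for
    the colours that cover the missing edge. *)
Definition k33_minus_costs : seq nat := [:: 1; 1; 2; 1; 1; 2; 2; 2; 0].

(* The coefficients are dual solutions of the linear programs over all column
   patterns. *)
Definition k33_minus_certs (m : seq nat) : seq cert :=
  if nth 0 m 0 == 1 then
    [:: Cert (nseq 9 4) [::] [:: 6; 3; 6; 3; 3; 6; 6; 6] 24;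
        Cert [::] [:: 2] [:: 2; 1; 2; 1; 1; 2; 2; 2] 0]
  else if nth 0 m 2 == 1 then
    [:: Cert [:: 0; 0; 0; 1; 1; 0; 1; 1] [:: 0; 0; 2] [::] 2;
        Cert [:: 0; 0; 0; 0; 0; 4] [:: 2; 2; 2; 2; 2; 0; 2; 2]
          [:: 5; 5; 20; 5; 5; 10; 10; 10] 0]
  else [:: Cert (nseq 9 2) [::] [:: 1; 1; 2; 1; 1; 2; 2; 2] 12].

Lemma k33_minus_certified :
  all (fun m => certified m (k33_minus_certs m)) k33_minus_mults.
Proof. by vm_compute. Qed.

Definition all_mults : seq (seq nat) := k33_mults ++ k33_minus_mults.

Lemma weigh_check : all (fun m => (size m == 9) &&
  all (fun ab => entry (k33_table m) ab.1 ab.2 == weigh m (edge_rows ab)) row_pairs)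
  all_mults.
Proof. by vm_compute. Qed.

Lemma weigh_edge_check : all (fun m =>
  all (fun x => weigh m (edge_rows x.1) == x.2) (zip k33_edges m)) all_mults.
Proof. by vm_compute. Qed.

Lemma ones_check : all (fun m => all (fun s =>
  (weight s == 2) && (0 < weigh m s) ==> (weigh (nseq 9 1) s == 1)) (all_rowsets 6))
  all_mults.
Proof. by vm_compute. Qed.

Lemma pair_check : all (fun s => (weight s == 2) == (s \in map edge_rows row_pairs))
  (all_rowsets 6).
Proof. by vm_compute. Qed.

Lemma foldr_minn_le x (l : seq nat) n : x \in l -> foldr minn n l <= x.
Proof.
elim: l => //= y l IHl; rewrite inE => /orP[/eqP->|/IHl]; first exact: geq_minl.
by apply: leq_trans; apply: geq_minr.
Qed.

Lemma disj_nil s : disj s [::] = true. Proof. by case: s. Qed.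

Lemma weigh_nil l : weigh l [::] = 0.
Proof.
rewrite /weigh; elim: (zip _ _) => // x xs IHx.
change (x.2 * false + sumn [seq y.2 * ([::] == edge_rows y.1) | y <- xs] = 0).
by rewrite IHx muln0.
Qed.

Lemma weight_edge x : x \in k33_edges -> weight (edge_rows x) = 2.
Proof.
by move/(allP (_ : all (fun x => weight (edge_rows x) == 2) k33_edges)) => /(_ isT)/eqP.
Qed.

Lemma mem_zip1 (S T : eqType) (s : seq S) (t : seq T) x : x \in zip s t -> x.1 \in s.
Proof.
elim: s t => [|a s IHs] [|b t] //=; rewrite !inE => /orP[/eqP->|/IHs ->].
  by rewrite eqxx.
by rewrite orbT.
Qed.

Lemma weigh_two l s : weight s != 2 -> weigh l s = 0.
Proof.
move=> s2; rewrite /weigh.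
have: {in zip k33_edges l, forall x, weight (edge_rows x.1) = 2}.
  by move=> x /mem_zip1/weight_edge.
elim: (zip _ _) => //= x xs IHx h; rewrite IHx => [|y yx]; last by apply: h; rewrite inE yx orbT.
rewrite addn0; case: eqP => [e|]; last by rewrite muln0.
by move: s2; rewrite e h ?mem_head.
Qed.

(** * Soundness of the column search *)

Section Columns.
Variables (q k : nat) (M : nat -> 'I_q -> 'I_k) (m : seq nat).
Hypothesis MP : achromatic_matrix M.
Hypotheses (q16 : 16 <= q) (kq : 2 * q + 5 <= k).
Hypotheses (mP : m \in all_mults) (tM : table M = k33_table m).

Local Notation tot := (total M).
Local Notation rows := (rows M).

Let size_m : size m = 9. Proof. by have /allP/(_ _ mP)/andP[/eqP] := weigh_check. Qed.

Lemma tot_eq_weigh s : size s = 6 -> weight s = 2 -> tot (fun t => t == s) = weigh m s.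
Proof.
move=> /mem_all_rowsets s6 s2; have /allP/(_ _ s6)/eqP := pair_check.
rewrite s2 => /esym/mapP[[a b] abE ->].
have /andP[ab b6] := row_pairs_lt abE.
have /allP/(_ _ mP)/andP[_ /allP/(_ _ abE)/eqP <-] := weigh_check.
by rewrite -tM entry_table ?(ltn_trans ab) // neq_ltn ab.
Qed.

Lemma weigh_rows_gt0 c : weight (rows c) = 2 -> 0 < weigh m (rows c).
Proof.
move=> c2; rewrite -tot_eq_weigh ?size_rows //.
by apply: leq_trans (leq_sum_term _ c); rewrite eqxx.
Qed.

Lemma tot_weigh l (g : rowset -> nat) : tot (fun s => weigh l s * g s) =
  sumn [seq x.2 * (weigh m (edge_rows x.1) * g (edge_rows x.1)) | x <- zip k33_edges l].
Proof.
transitivity (tot (fun s => sumn [seq x.2 * g (edge_rows x.1) * (s == edge_rows x.1) |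
    x <- zip k33_edges l])).
  apply: eq_tot => c; rewrite /weigh; elim: (zip _ _) => //= x xs IHx.
  rewrite mulnDl IHx; congr (_ + _); case: eqP => [->|]; last by rewrite !muln0.
  by rewrite !muln1.
rewrite tot_sumn; congr sumn; apply/eq_in_map => x /mem_zip1/weight_edge x2.
by rewrite totMl tot_eq_weigh ?size_mkseq // mulnAC mulnA.
Qed.

Lemma tot_two_disj e : tot (fun s => (weight s == 2) && disj e s) = disj_mult m e.
Proof.
transitivity (tot (fun s => weigh (nseq 9 1) s * disj e s)).
  apply: eq_tot => c; case: eqP => [c2|/eqP/weigh_two ->] //=.
  have /allP/(_ _ mP)/allP/(_ _ (mem_all_rowsets (size_rows M c))) := ones_check.
  by rewrite c2 weigh_rows_gt0 // => /eqP ->; rewrite mul1n.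
rewrite tot_weigh /disj_mult.
transitivity (sumn [seq weigh m (edge_rows x) * disj e (edge_rows x) | x <- k33_edges]).
  rewrite -[zip _ _]/[seq (x, 1) | x <- k33_edges] -map_comp; congr sumn.
  by apply: eq_map => x /=; rewrite mul1n.
rewrite -{1}(@unzip1_zip _ _ k33_edges m) ?size_m // -map_comp; congr sumn.
apply/eq_in_map => x xm /=.
by have /allP/(_ _ mP)/allP/(_ _ xm)/eqP -> := weigh_edge_check.
Qed.

Lemma two_card_le4 e j : weight e = 2 -> size e = 6 ->
  \sum_(i < 6) ((weight (rows (M i j)) == 2) && disj e (rows (M i j))) <= 4.
Proof.
move=> e2 e6; have : \sum_(i < 6) has_row e i + \sum_(i < 6) ~~ has_row e i = 6.
  rewrite -big_split /= -[RHS]card_ord -sum1_card; apply: eq_bigr => i _.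
  by case: has_row.
rewrite -weightE // e2 => e4; apply: (@leq_trans (\sum_(i < 6) ~~ has_row e i)); last by lia.
apply: leq_sum => i _; case: (_ == 2) => //=; case dj: (disj _ _) => //.
by case: (boolP (has_row e i)) => // ei; case: (disjP _ _ dj i ei); apply: has_row_cell.
Qed.

Lemma crowded_cell i j : i < 6 -> weight (rows (M i j)) = 2 ->
  disj_mult m (rows (M i j)) <= 4 + \sum_(i' < 6)
    ((weight (rows (M i' j)) == 2) && disj (rows (M i j)) (rows (M i' j))).
Proof.
move=> i6 e2; set e := rows _ in e2 *.
have h1 := @tot_leq_col_sum _ _ _ MP (M i j) (fun s => (weight s == 2) && disj e s).
have h2 := @col_sum_ge_slack _ _ _ MP i j (fun j0 => \sum_(i' < 6)
  ((weight (rows (M i' j0)) == 2) && disj e (rows (M i' j0)))) 4 i6.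
have {}h2 := h2 (fun j' => two_card_le4 j' e2 (size_rows M _)).
rewrite -tot_two_disj; move: h1 h2; rewrite -/e e2 => /(_ erefl) h1 h2.
by have {}h1 := h1 (fun s h => proj2 (andP h)); lia.
Qed.

Lemma col_bad_le_avoid i j : i < 6 -> weight (rows (M i j)) = 2 ->
  col_bad M (rows (M i j)) j + tot (disj (rows (M i j))) <= 8.
Proof.
move=> i6 e2; have := @disj_bad_bound _ _ _ MP (M i j); rewrite e2 => /(_ erefl).
by have := @col_sum_ge _ _ M i j (col_bad M (rows (M i j))) i6; lia.
Qed.

Lemma avoid_ge e : size e = 6 -> weight e = 2 -> weigh m e + 5 <= tot (disj e).
Proof.
move=> e6 e2; have /allP/(_ _ (mem_all_rowsets e6))/eqP := pair_check.
rewrite e2 => /esym/mapP[[a b] /row_pairs_lt /andP[ab b6] eE].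
have a6 := ltn_trans ab b6; have nab : a != b by rewrite neq_ltn ab.
rewrite -tot_eq_weigh // eE -[edge_rows _]/(pair_rows a b).
have := covers_avoids MP q16 kq a6 b6 nab; have := mult_le_covers M a6 b6.
rewrite (eq_tot (g1 := disj (pair_rows a b)) (g2 := avoids a b)) => [|c]; last by rewrite disj_pair.
by rewrite /mult; lia.
Qed.

Lemma col_bad_le_slack i j : i < 6 -> weight (rows (M i j)) = 2 ->
  col_bad M (rows (M i j)) j <= slack m (rows (M i j)).
Proof.
move=> i6 e2; have := col_bad_le_avoid i6 e2; have := avoid_ge (size_rows M _) e2.
have : disj_mult m (rows (M i j)) <= tot (disj (rows (M i j))).
  by rewrite -tot_two_disj; apply: leq_sum => c _; case: (_ == 2).
by rewrite /slack leq_min; lia.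
Qed.

Lemma col_sum_leq_tot (P : pred rowset) j : \sum_(i < 6) P (rows (M i j)) <= tot P.
Proof.
under eq_bigr => i _.
  rewrite [nat_of_bool _](_ : _ = \sum_(c < k) (M i j == c) * P (rows c)); last first.
    rewrite (bigD1 (M i j)) //= eqxx mul1n big1 ?addn0 // => c.
    by rewrite eq_sym => /negbTE ->.
  over.
rewrite exchange_big; apply: leq_sum => c _; rewrite -big_distrl /=.
by case: (P _); rewrite ?muln0 ?muln1 // col_card.
Qed.

Definition blank (s : rowset) : rowset := if weight s == 2 then s else [::].
Definition pattern (j : 'I_q) : seq rowset := mkseq (fun i => blank (rows (M i j))) 6.

Arguments pattern : simpl never.

Lemma sumn_pattern (h : rowset -> nat) j :
  sumn (map h (pattern j)) = \sum_(i < 6) h (blank (rows (M i j))).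
Proof.
by rewrite sumnE big_map big_map -(big_mkord xpredT (fun i => h (blank (rows (M i j))))).
Qed.

Lemma count_pattern (p : pred rowset) j :
  count p (pattern j) = \sum_(i < 6) p (blank (rows (M i j))).
Proof. by rewrite -sumn_count sumn_pattern. Qed.

Lemma nth_pattern j i : i < 6 -> nth [::] (pattern j) i = blank (rows (M i j)).
Proof. by move=> i6; rewrite nth_mkseq. Qed.

Lemma pattern_mem j e : e \in pattern j -> e != [::] ->
  exists2 i, i < 6 & rows (M i j) = e /\ weight e = 2.
Proof.
case/mapP=> i; rewrite mem_iota => /= i6 ->; rewrite /blank.
by case: (weight _ =P 2) => // w2 _; exists i.
Qed.

Lemma pattern_not_pruned j n : ~~ pruned m (take n (pattern j)).
Proof.
apply/negP; rewrite /pruned; case: ifP => // _.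
rewrite lazy_hasE => /hasP[e /mem_take epat]; case: ifP => // /negbT e0.
have [i i6 [re e2]] := pattern_mem epat e0; have e6 : size e = 6 by rewrite -re size_rows.
have cnt : count_mem e (take n (pattern j)) <= weigh m e.
  rewrite -tot_eq_weigh //; apply: leq_trans (col_sum_leq_tot (fun s => s == e) j).
  apply: leq_trans (_ : count_mem e (pattern j) <= _).
    by rewrite -{2}(cat_take_drop n (pattern j)) count_cat leq_addr.
  rewrite count_pattern; apply: leq_sum => i' _ /=; rewrite /blank.
  by case: (weight _ == 2) => //; case: eqP => // h; rewrite -h in e0.
have bad : bad_cells (take n (pattern j)) e <= slack m e.
  rewrite -re; apply: leq_trans (col_bad_le_slack i6 _); last by rewrite re.
  rewrite re /bad_cells -sumn_count sumnE big_map -[iota 0 6]/(index_iota 0 6) big_mkord.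
  apply: leq_sum => i' _; case: (has_row e i') => //=.
  case: (ltnP i' n) => ni'; last first.
    by rewrite nth_default ?disj_nil // size_take_min geq_min ni'.
  rewrite nth_take // nth_pattern // /blank; case: (_ == 2) => //.
  by rewrite disj_nil.
by case: ifP => _; rewrite !ltnNge cnt /= ?bad.
Qed.

Lemma pattern_crowded j : crowded m (pattern j).
Proof.
apply/allP => e epat; apply/orP; case: (eqVneq e [::]) => [|e0]; [by left|right].
have [i i6 [re e2]] := pattern_mem epat e0.
have := @crowded_cell i j i6; rewrite re => /(_ e2) h; apply: leq_trans h _.
rewrite leq_add2l count_pattern; apply: leq_sum => i' _; rewrite /blank.
by case: (weight (rows (M i' j)) =P 2) => //= w2; case: eqP.
Qed.

Lemma pattern_option i j : i < 6 -> blank (rows (M i j)) \in cell_options m i.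
Proof.
move=> i6; rewrite /blank; case: eqP => [w2|_]; last by rewrite inE eqxx.
rewrite inE; apply/orP; right; have := weigh_rows_gt0 w2; set e := rows _.
have ei : has_row e i by apply: has_row_cell.
rewrite /weigh; elim: (zip _ _) => //= x xs IHx.
case: (eqVneq e (edge_rows x.1)) => [ex|_].
  rewrite muln1 -ex ei andbT; case: (posnP x.2) => [->|_ _]; first by rewrite add0n.
  by rewrite /= inE ex eqxx.
by rewrite muln0 => /IHx h; case: ifP => // _; rewrite inE h orbT.
Qed.

Lemma pattern_searchP xs opts c cs : pattern_search m xs opts c ->
  size cs = size opts -> (forall i, i < size cs -> nth [::] cs i \in nth [::] opts i) ->
  (forall n, ~~ pruned m (take n (c ++ cs))) -> pattern_ok m xs (c ++ cs).
Proof.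
elim: opts c cs => [|o opts IHo] c [|s cs] //=.
  rewrite cats0 => + _ _ /(_ (size c)); rewrite take_size.
  by case: (pruned m c).
case: ifP => [pr _ _ _ /(_ (size c))|_ /allP h [sz] opt np].
  by rewrite take_size_cat // pr.
rewrite -cat_rcons; apply: IHo => //; first exact: h (opt 0 isT).
- by move=> i ics; apply: (opt i.+1).
- by move=> n; rewrite cat_rcons.
Qed.

Lemma hit_cost_pattern W i j s : hit_cost [seq (e, weigh W e) | e <- pattern j & e != [::]] i s =
  \sum_(i' < 6) weigh W (rows (M i' j)) *
    (~~ has_row (rows (M i' j)) i && ~~ disj (rows (M i' j)) s).
Proof.
rewrite /hit_cost -map_comp.
rewrite (_ : sumn _ = sumn [seq weigh W e * (~~ has_row e i && ~~ disj e s) | e <- pattern j]).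
  rewrite sumn_pattern; apply: eq_bigr => i' _; rewrite /blank.
  by case: eqP => // /eqP w2; rewrite weigh_nil weigh_two.
elim: (pattern j) => //= e c IHc; case: eqP => [->|_] /=; last by rewrite IHc.
by rewrite weigh_nil.
Qed.

Lemma min_cost_pattern W j : min_cost W (pattern j) <=
  \sum_(i < 6) weigh W (rows (M i j)) * col_bad M (rows (M i j)) j.
Proof.
under eq_bigr do rewrite big_distrr.
rewrite exchange_big /min_cost; cbv zeta.
rewrite sumnE big_map -[iota 0 6]/(index_iota 0 6) big_mkord; apply: leq_sum => i _.
rewrite nth_pattern // /blank; case: (weight _ =P 2) => w2; last first.
  rewrite eqxx /min_hit_cost -hit_cost_pattern; apply: foldr_minn_le.
  apply/map_f; rewrite mem_filter has_row_cell // mem_filter.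
  rewrite mem_all_rowsets ?size_rows // andbT /=.
  by have := weight_rows_ge2 MP q16 kq (M i j); lia.
case: eqP => [e0|_]; last by rewrite hit_cost_pattern.
by have := size_rows M (M i j); rewrite e0.
Qed.

Lemma sum_pattern_weigh l : \sum_(j < q) sumn (map (weigh l) (pattern j)) =
  2 * sumn [seq x.2 * weigh m (edge_rows x.1) | x <- zip k33_edges l].
Proof.
have -> : sumn [seq x.2 * weigh m (edge_rows x.1) | x <- zip k33_edges l] = tot (weigh l).
  rewrite (eq_tot (g2 := fun s => weigh l s * 1)) => [|c]; last by rewrite muln1.
  by rewrite tot_weigh; congr sumn; apply: eq_map => x; rewrite muln1.
under eq_bigr do rewrite sumn_pattern.
rewrite exchange_big /= -totMl.
transitivity (\sum_(i < 6) \sum_(c < k) has_row (rows c) i * weigh l (rows c)).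
  apply: eq_bigr => i _; rewrite -(row_sum MP) //; apply: eq_bigr => j _.
  by rewrite /blank; case: eqP => // /eqP w2; rewrite weigh_nil weigh_two.
rewrite exchange_big; apply: eq_bigr => c _; rewrite -big_distrl /= -weightE ?size_rows //.
by case: (weight (rows c) =P 2) => [->//|/eqP w2]; rewrite weigh_two ?muln0.
Qed.

(** Weighted sum of [disj_bad_bound]: of the 8 cells of a two-cell colour, those needed by the
    avoiding colours are not wasted. *)
Lemma sum_col_bad W :
  \sum_(j < q) \sum_(i < 6) weigh W (rows (M i j)) * col_bad M (rows (M i j)) j <=
  sumn [seq x.2 * (weigh m (edge_rows x.1) * (8 - tot (disj (edge_rows x.1)))) |
        x <- zip k33_edges W].
Proof.
rewrite -(tot_weigh W (fun s => 8 - tot (disj s))).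
have -> : \sum_(j < q) \sum_(i < 6) weigh W (rows (M i j)) * col_bad M (rows (M i j)) j =
  \sum_(c < k) weigh W (rows c) * col_sum M c (col_bad M (rows c)).
  transitivity (\sum_(c < k) \sum_(j < q) \sum_(i < 6)
    (M i j == c) * (weigh W (rows c) * col_bad M (rows c) j)).
    rewrite [RHS]exchange_big; apply: eq_bigr => j _; rewrite [RHS]exchange_big.
    apply: eq_bigr => i _; rewrite (bigD1 (M i j)) //= eqxx mul1n big1 ?addn0 // => c.
    by rewrite eq_sym => /negbTE ->.
  apply: eq_bigr => c _; rewrite /col_sum big_distrr; apply: eq_bigr => j _.
  by rewrite [RHS]big_distrr; apply: eq_bigr => i _; rewrite mulnCA.
apply: leq_sum => c _; case: (weight (rows c) =P 2) => [w2|/eqP w2]; last by rewrite weigh_two.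
rewrite leq_mul2l; apply/orP; right.
by have := @disj_bad_bound _ _ _ MP c; rewrite w2 => /(_ erefl); lia.
Qed.

Definition used (j : 'I_q) : bool :=
  has (fun i => weight (rows (M i j)) == 2) (iota 0 6).
Arguments used : simpl never.

Definition used_columns : nat := \sum_(j < q) used j.

(** The factors 2 count the two cells of a two-cell colour; columns without such colours add nothing
    to the left side. *)
Lemma cert_bound xs x0 n x : certified m xs -> n < size xs -> nth x0 xs n = x ->
  base x * used_columns +
    2 * sumn [seq y.2 * weigh m (edge_rows y.1) | y <- zip k33_edges (loss x)] <=
  2 * sumn [seq y.2 * weigh m (edge_rows y.1) | y <- zip k33_edges (gain x)] +
  sumn [seq y.2 * (weigh m (edge_rows y.1) * (8 - tot (disj (edge_rows y.1)))) |
        y <- zip k33_edges (penalty x)].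
Proof.
move=> cert nxs xE; apply: leq_trans (leq_add (leqnn _) (sum_col_bad (penalty x))).
rewrite -!sum_pattern_weigh /used_columns big_distrr -!big_split /=; apply: leq_sum => j _.
apply: leq_trans (leq_add (leqnn _) (min_cost_pattern _ _)).
have : pattern_ok m xs ([::] ++ pattern j).
  apply: (pattern_searchP cert) => [|i|r]; first by rewrite size_mkseq.
    rewrite size_mkseq => i6; rewrite nth_pattern // (nth_map 0) ?size_iota //.
    by rewrite nth_iota // add0n; apply: pattern_option.
  exact: pattern_not_pruned.
rewrite cat0s /pattern_ok pattern_crowded; case: ifP =>
  [/allP bl _|_ /(all_nthP x0)/(_ _ nxs) ok]; last rewrite xE in ok.
  have blank_nil i : i < 6 -> blank (rows (M i j)) = [::].
    by move=> i6; apply/eqP/bl; rewrite -nth_pattern // mem_nth // size_mkseq.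
  rewrite [nat_of_bool _](_ : _ = 0) ?muln0; last first.
    apply/eqP; rewrite eqb0 /used; apply/hasPn => i; rewrite mem_iota => /= i6.
    by have := blank_nil i i6; rewrite /blank; case: eqP.
  by rewrite !blank_nil // !weigh_nil.
apply: leq_trans ok; rewrite leq_add2r -{2}[base x]muln1 leq_mul2l.
by case: used; rewrite orbT.
Qed.

End Columns.

(** * Excluding K33 and K33 minus an edge *)

Definition side0 : rowset := [:: true; true; true; false; false; false].
Definition side1 : rowset := [:: false; false; false; true; true; true].

Definition admissible (m : seq nat) (s : rowset) : bool :=
  (3 <= weight s) || ((weight s == 2) && (0 < weigh m s)).

Definition mixed (s : rowset) : bool := [&& 3 <= weight s, s != side0 & s != side1].

(** * Colours that live on a whole side *)

Section Sides.
Variables (q k : nat) (M : nat -> 'I_q -> 'I_k).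
Hypothesis MP : achromatic_matrix M.
Variables (T U : rowset).
Hypotheses (T6 : size T = 6) (T3 : weight T = 3) (U6 : size U = 6) (U3 : weight U = 3).
Hypothesis TU : disj T U.
Hypothesis onlyU : forall c, disj T (rows M c) -> rows M c = U.

Local Notation tot := (total M).
Local Notation rows := (rows M).

Lemma opposite_le9 : 0 < tot (fun s => s == T) -> tot (fun s => s == U) <= 9.
Proof.
case/(@tot_gt0 _ _ M (fun s => s == T)) => c /eqP rc.
have := @disj_bad_bound _ _ _ MP c; rewrite rc T3 => /(_ erefl); apply: leq_trans.
apply: leq_trans (leq_addr _ _); apply: leq_sum => d _.
by case: eqP => // ->; rewrite TU.
Qed.

Hypotheses (U9 : tot (fun s => s == U) = 9) (T7 : 7 <= tot (fun s => s == T)).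

(** The three columns of a [T]-colour have nine cells off [T], and the nine [U]-colours need all of
    them. *)
Lemma column_with_T i i' j : i < 6 -> i' < 6 -> rows (M i j) = T -> ~~ has_row T i' ->
  rows (M i' j) = U.
Proof.
move=> i6 i'6 rT ni'; apply: onlyU; apply/negPn/negP => nd.
have := @disj_bad_bound _ _ _ MP (M i j); rewrite rT T3 => /(_ erefl).
have : tot (fun s => s == U) <= tot (disj T).
  by apply: leq_sum => d _; case: eqP => // ->; rewrite TU.
have := @col_sum_ge _ _ M i j (col_bad M T) i6.
have : 0 < col_bad M T j.
  by apply: leq_trans (leq_sum_term _ (Ordinal i'6)); rewrite /= ni' nd.
by rewrite U9; lia.
Qed.

(** Two columns hold at most six [T]-cells, fewer than the seven [T]-colours that a [U]-colour has
    to meet. So each of its three columns contributes one. *)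
Lemma column_with_U i j : i < 6 -> rows (M i j) = U ->
  exists2 i', i' < 6 & rows (M i' j) = T.
Proof.
move=> i6 rU; have h1 := @tot_leq_col_sum _ _ _ MP (M i j) (fun s => s == T).
have h2 := @col_sum_ge_slack _ _ _ MP i j (fun j0 => \sum_(i' < 6) (rows (M i' j0) == T)) 3 i6.
have F3 j0 : \sum_(i' < 6) (rows (M i' j0) == T) <= 3.
  apply: leq_trans (eq_leq T3); rewrite weightE //; apply: leq_sum => i' _.
  by case: eqP => // <-; rewrite has_row_cell.
have dU s : s == T -> disj U s.
  by move=> /eqP ->; apply/disjP => r ur tr; apply: (disjP _ _ TU r).
rewrite rU U3 in h1 h2; have {}h1 := h1 erefl dU; have {}h2 := h2 F3.
case: (pickP (fun i' : 'I_6 => rows (M i' j) == T)) => [i' /eqP|none]; first by exists i'.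
by move: h2; rewrite [X in _ <= _ + X]big1 => [|i' _]; [lia | rewrite none].
Qed.

(** A column with a [T]- or [U]-colour has a [T]-cell and hence three [U]-cells; the 27 [U]-cells
    allow nine such columns. Any further column without two-cell colours would consist of six mixed
    colours. *)
Lemma used_columns_ge : tot mixed <= 5 ->
  (forall s, (s == T) || (s == U) = (s == side0) || (s == side1)) ->
  (forall c, 2 <= weight (rows c)) -> q <= used_columns M + 9.
Proof.
move=> mix5 TUs w2.
pose far (j : 'I_q) := has (fun i => (rows (M i j) == T) || (rows (M i j) == U)) (iota 0 6).
have far9 : \sum_(j < q) far j <= 9.
  rewrite -(leq_pmul2l (isT : 0 < 3));
    apply: (@leq_trans (\sum_(j < q) \sum_(i < 6) (rows (M i j) == U))).
    rewrite big_distrr; apply: leq_sum => j _ /=; case fj: (far j) => //.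
    have [i i6 rT] : exists2 i, i < 6 & rows (M i j) = T.
      have /hasP[i] := fj; rewrite mem_iota => /= i6 /orP[]/eqP r; first by exists i.
      exact: column_with_U r.
    rewrite muln1 -[X in X <= _]U3 weightE //; apply: leq_sum => i' _.
    case ui': (has_row U i') => //; rewrite (column_with_T i6 (ltn_ord i') rT) ?eqxx //.
    by apply/negP => ti'; apply: (disjP _ _ TU i').
  rewrite exchange_big /=.
  rewrite (eq_bigr (fun i : 'I_6 => has_row U i * 9)) => [|i _].
    by rewrite -big_distrl /= -weightE // U3.
  rewrite (row_sum MP (fun c => rows c == U : nat)) // -U9 /total big_distrr.
  by apply: eq_bigr => c _ /=; case: eqP => [->|]; rewrite ?muln0.
apply: leq_trans (leq_add (leqnn _) far9); rewrite /used_columns -big_split.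
rewrite -[X in X <= _]card_ord -sum1_card; apply: leq_sum => j _ /=.
case: (boolP (used M j)) => //= /hasPn nu; case: (boolP (far j)) => // /hasPn nf.
have := col_sum_leq_tot MP mixed j; rewrite (eq_bigr (fun=> 1)) => [|i _].
  by rewrite sum1_card card_ord; lia.
have ii : val i \in iota 0 6 by rewrite mem_iota ltn_ord.
have := nf _ ii; rewrite TUs negb_or /mixed => /andP[-> ->]; rewrite !andbT.
by have := nu _ ii; have := w2 (M i j); case: (weight _) => [|[|[|w]]].
Qed.

End Sides.

Definition holds_on (ms : seq (seq nat)) (P : pred rowset) : bool :=
  all (fun m => all (fun s => admissible m s ==> P s) (all_rowsets 6)) ms.

Definition outside (s : rowset) : bool := (s != side0) && (s != side1).

Definition covered (e : nat * nat) (s : rowset) : nat := covers e.1 e.2 s.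

Arguments covered : simpl never.

Lemma row0_check : holds_on all_mults (fun s => has_row s 0 <=
  (s == side0) + (covers 0 3 s + covers 0 4 s + covers 0 5 s)).
Proof. by vm_compute. Qed.

Lemma row3_check : holds_on all_mults (fun s => has_row s 3 <=
  (s == side1) + (covers 0 3 s + covers 1 3 s + covers 2 3 s)).
Proof. by vm_compute. Qed.

Lemma sides_check : holds_on all_mults (fun s =>
  (disj side0 s ==> (s == side1)) && (disj side1 s ==> (s == side0))).
Proof. by vm_compute. Qed.

(** A set with [r] rows on one side and [t] on the other covers [r * t] edges. Outside the sides
    both are positive and the claim is [(r - 1) * (t - 1) >= 0]; on a side it is [3 <= 3]. *)
Lemma k33_cost_check : holds_on k33_mults (fun s => 2 * outside s + weight s <=
  sumn [seq covered e s | e <- k33_edges] + 3).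
Proof. by vm_compute. Qed.

(** The set [{0, 2, 5}] covers only [{0, 5}] besides the missing edge, so that edge has to count
    double. The additional [weigh] term is what two-cell colours on doubled edges gain. *)
Lemma k33_minus_cost_check : holds_on k33_minus_mults (fun s =>
  2 * outside s + weight s + weigh [:: 0; 0; 1; 0; 0; 1; 1; 1] s <=
  sumn [seq x.2 * covered x.1 s | x <- zip k33_edges k33_minus_costs] + 3).
Proof. by vm_compute. Qed.

Section Final.
Variables (q k : nat) (M : nat -> 'I_q -> 'I_k) (m : seq nat).
Hypothesis MP : achromatic_matrix M.
Hypotheses (q16 : 16 <= q) (kq : 2 * q + 5 <= k).
Hypotheses (mP : m \in all_mults) (tM : table M = k33_table m).

Local Notation tot := (total M).
Local Notation rows := (rows M).
Local Notation y := (tot (fun s => s == side0)).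
Local Notation z := (tot (fun s => s == side1)).
Local Notation avoided e := (tot (disj (edge_rows e))).

Lemma admissible_rows c : admissible m (rows c).
Proof.
rewrite /admissible; have := weight_rows_ge2 MP q16 kq c.
by have := @weigh_rows_gt0 _ _ _ _ mP tM c; case: (weight _) => [|[|[|w]]] //= ->.
Qed.

Lemma holdsP ms P c : m \in ms -> holds_on ms P -> P (rows c).
Proof.
move=> mms /allP/(_ _ mms)/allP/(_ _ (mem_all_rowsets (size_rows M c))).
by rewrite admissible_rows.
Qed.

Lemma leq_tot_on ms g1 g2 : m \in ms -> holds_on ms (fun s => g1 s <= g2 s) ->
  tot g1 <= tot g2.
Proof. by move=> mms h; apply: leq_sum => c _; apply: (holdsP c mms h). Qed.

Lemma edge_bounds a b : (a, b) \in row_pairs -> 0 < weigh m (edge_rows (a, b)) ->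
  tot (covers a b) + k = avoided (a, b) + 2 * q /\ avoided (a, b) <= 8.
Proof.
move=> abE m0; have /andP[ab b6] := row_pairs_lt abE; have a6 := ltn_trans ab b6.
have nab : a != b by rewrite neq_ltn ab.
have dE : avoided (a, b) = tot (avoids a b) by apply: eq_tot => c; rewrite -disj_pair.
rewrite dE; split; first exact: covers_avoids.
apply: avoids_le8 => //; by rewrite /mult (tot_eq_weigh mP tM) ?size_mkseq ?weight_pair.
Qed.

Lemma core_pos : all (fun ab => 0 < weigh m (edge_rows ab))
  [:: (0, 3); (0, 4); (0, 5); (1, 3); (2, 3)].
Proof.
exact: (allP (_ : all (fun m => all (fun ab => 0 < weigh m (edge_rows ab))
  [:: (0, 3); (0, 4); (0, 5); (1, 3); (2, 3)]) all_mults) _ mP).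
Qed.

Lemma only_side1 c : disj side0 (rows c) -> rows c = side1.
Proof. by have /andP[/implyP h _] := holdsP c mP sides_check => /h/eqP. Qed.

Lemma only_side0 c : disj side1 (rows c) -> rows c = side0.
Proof. by have /andP[_ /implyP h] := holdsP c mP sides_check => /h/eqP. Qed.

(** Rows 0 and 3 give [y, z >= q - 9 > 0], so both sides occur and [opposite_le9] applies. With
    [k > 2 * q + 5] each edge would be covered by at most two colours, and [y >= q - 6 > 9]. *)
Lemma sides_bounds : [/\ k = 2 * q + 5, q - 9 <= y <= 9 & q - 9 <= z <= 9].
Proof.
have /and5P[m03 m04 m05 m13 /andP[m23 _]] := core_pos.
have [e03 n03] := edge_bounds (isT : (0, 3) \in row_pairs) m03.
have [e04 n04] := edge_bounds (isT : (0, 4) \in row_pairs) m04.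
have [e05 n05] := edge_bounds (isT : (0, 5) \in row_pairs) m05.
have [e13 n13] := edge_bounds (isT : (1, 3) \in row_pairs) m13.
have [e23 n23] := edge_bounds (isT : (2, 3) \in row_pairs) m23.
have r0 := leq_tot_on mP row0_check; have r3 := leq_tot_on mP row3_check.
rewrite !totD tot_row // in r0; rewrite !totD tot_row // in r3.
have zy : 0 < y -> z <= 9 by apply: (@opposite_le9 _ _ M MP side0 side1).
have yz : 0 < z -> y <= 9 by apply: (@opposite_le9 _ _ M MP side1 side0).
have y0 : 0 < y by lia. have z0 : 0 < z by lia.
by have := zy y0; have := yz z0; split; lia.
Qed.

Lemma outsideE : tot outside + y + z = k.
Proof.
apply: etrans (tot1 M); rewrite -!totD; apply: eq_tot => c; rewrite /outside.
by case: eqP => [->|_] //=; case: eqP.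
Qed.

Lemma tot_const n : tot (fun=> n) = n * k.
Proof. by rewrite /total sum_nat_const card_ord mulnC. Qed.

Lemma two_cell_total : tot (fun s => weight s == 2) = sumn m.
Proof.
have -> : sumn m = sumn (table M).
  by rewrite tM; apply/eqP; apply: (allP (_ : all (fun m => sumn m == sumn (k33_table m))
    all_mults) _ mP).
rewrite /table /mult -tot_sumn; apply/eqP; rewrite eqn_leq.
by apply/andP; split; apply: (@leq_tot _ _ M predT) => //; vm_compute.
Qed.

Lemma outside_split : tot outside = sumn m + tot mixed.
Proof.
rewrite -two_cell_total -totD; apply: eq_tot => c.
have := weight_rows_ge2 MP q16 kq c; rewrite /outside /mixed.
case: (rows c =P side0) => [->|_] //; case: (rows c =P side1) => [->|_] //=.
by case: (weight _) => [|[|[|w]]].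
Qed.

Lemma used_columns_ge7 : (y == 9) || (z == 9) -> tot mixed <= 5 -> q <= used_columns M + 9.
Proof.
have [_ /andP[y7 _] /andP[z7 _]] := sides_bounds.
move=> yz9 mix5; have w2 := weight_rows_ge2 MP q16 kq.
case/orP: yz9 => /eqP e9.
  apply: (@used_columns_ge _ _ _ MP side1 side0) => //; first exact: only_side0.
    by apply: leq_trans z7; lia.
  by move=> s; rewrite orbC.
apply: (@used_columns_ge _ _ _ MP side0 side1) => //; first exact: only_side1.
by apply: leq_trans y7; lia.
Qed.

Lemma k33_cost : m \in k33_mults ->
  2 * tot outside + 6 * q <= sumn [seq tot (covered e) | e <- k33_edges] + 3 * k.
Proof.
move=> mk; have := leq_tot_on mk k33_cost_check.
rewrite (totD M (fun s => 2 * outside s)) totMl (tot_weight MP).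
by rewrite (totD M (fun s => sumn _)) tot_sumn tot_const.
Qed.

Lemma k33_minus_cost : m \in k33_minus_mults ->
  2 * tot outside + 6 * q + tot (weigh [:: 0; 0; 1; 0; 0; 1; 1; 1]) <=
  sumn [seq x.2 * tot (covered x.1) | x <- zip k33_edges k33_minus_costs] + 3 * k.
Proof.
move=> mk; have := leq_tot_on mk k33_minus_cost_check.
rewrite (totD M (fun s => 2 * outside s + weight s)) (totD M (fun s => 2 * outside s)).
rewrite totMl (tot_weight MP) (totD M (fun s => sumn _)) tot_sumn tot_const.
by under eq_map do rewrite totMl.
Qed.

End Final.

Ltac eval_weigh H := repeat match type of H with
  context [weigh ?l (edge_rows ?e)] =>
    let v := eval vm_compute in (weigh l (edge_rows e)) in
    change (weigh l (edge_rows e)) with v in H end.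

Ltac abstract_slack := repeat match goal with
  H : context [8 - ?t] |- _ => let x := fresh "x" in
    set (x := 8 - t) in *; clearbody x end.

Definition hits0 (s : rowset) : nat := has_row s 0 + has_row s 1 + has_row s 2.

Definition missing (s : rowset) : nat :=
  sumn [seq (mixed s && disj (edge_rows e) s : nat) | e <- k33_edges].

Definition huge (s : rowset) : bool := mixed s && (5 <= weight s).

Definition leaning (s : rowset) : bool := [&& mixed s, weight s == 4 & hits0 s == 3].

(** In the application [missing] and [huge] have total 0. A mixed colour then has exactly four rows,
    including a whole side, hence three or one rows in [side0]. The error terms make the
    inequalities true for all sets. *)
Lemma balanced_check : holds_on [:: nseq 9 2] (fun s =>
  [&& weight s == 2 * (weight s == 2) + 3 * (s == side0) + 3 * (s == side1) +
                  mixed s * weight s,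
      hits0 s == (weight s == 2) + 3 * (s == side0) + mixed s * hits0 s,
      4 * mixed s + huge s <= mixed s * weight s + missing s,
      mixed s * hits0 s <= mixed s + 2 * leaning s + 6 * (missing s + huge s) &
      mixed s + 2 * leaning s <= mixed s * hits0 s + 6 * (missing s + huge s)]).
Proof. by vm_compute. Qed.

Section K33.
Variables (q k : nat) (M : nat -> 'I_q -> 'I_k) (m : seq nat).
Hypothesis MP : achromatic_matrix M.
Hypotheses (q16 : 16 <= q) (kq : 2 * q + 5 <= k).
Hypotheses (mP : m \in all_mults) (tM : table M = k33_table m).

Local Notation tot := (total M).
Local Notation rows := (rows M).
Local Notation y := (tot (fun s => s == side0)).
Local Notation z := (tot (fun s => s == side1)).
Local Notation avoided e := (tot (disj (edge_rows e))).

Lemma covered_avoided e : e \in k33_edges -> 0 < weigh m (edge_rows e) ->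
  tot (covered e) + 5 = avoided e /\ avoided e <= 8.
Proof.
have [kE _ _] := sides_bounds MP q16 kq mP tM.
case: e => a b eK m0; have abE : (a, b) \in row_pairs.
  exact: (allP (_ : all (fun e => e \in row_pairs) k33_edges) _ eK).
have [h1 h2] := edge_bounds MP q16 kq mP tM abE m0; split=> //.
by have -> : tot (covered (a, b)) = tot (covers a b) by []; lia.
Qed.

Lemma disj_mult_avoided e : disj_mult m (edge_rows e) <= avoided e.
Proof.
rewrite -(tot_two_disj mP tM); apply: leq_sum => c _.
by case: (weight _ == 2); case: disj.
Qed.

(** A parity argument. Three mixed colours share [96 - 36 - 48 = 12] cells, so each has four. In
    rows 0, 1, 2 they fill [48 - 18 - 24 = 6] cells, but each of them fills 1 or 3 there, an odd
    total. *)
Lemma balanced_absurd : m = nseq 9 2 -> q = 16 -> y = 8 -> z = 8 -> False.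
Proof.
move=> m2 qE y8 z8; have [kE _ _] := sides_bounds MP q16 kq mP tM.
have mk : m \in [:: nseq 9 2] by rewrite m2 inE.
have wE := outsideE M; have mixE := outside_split MP q16 kq mP tM.
have two := two_cell_total mP tM.
have H c := holdsP MP q16 kq mP tM c mk balanced_check.
have av e : e \in k33_edges -> tot (fun s => mixed s && disj (edge_rows e) s) = 0.
  move=> eK; have m0 : 0 < weigh m (edge_rows e).
    rewrite m2; exact: (allP (_ : all (fun e => 0 < weigh (nseq 9 2) (edge_rows e))
      k33_edges) _ eK).
  have [_] := covered_avoided eK m0.
  have : disj_mult m (edge_rows e) + tot (fun s => mixed s && disj (edge_rows e) s) <=
         avoided e.
    rewrite -(tot_two_disj mP tM) -totD; apply: leq_sum => c _; rewrite /mixed.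
    by case: eqP => [->|_] //=; case: disj; rewrite ?andbF //; case: (_ && _).
  rewrite m2 (_ : disj_mult _ _ = 8); first by lia.
  by apply/eqP; apply: (allP (_ : all (fun e => disj_mult (nseq 9 2) (edge_rows e) == 8)
    k33_edges) _ eK).
have miss0 : tot missing = 0.
  rewrite tot_sumn; apply/eqP/natnseq0P; apply/all_pred1P/allP => x /mapP[e eK ->] /=.
  by apply/eqP/av.
have W := tot_weight MP.
have e1 : tot weight = tot (fun s => 2 * (weight s == 2) + 3 * (s == side0) +
    3 * (s == side1) + mixed s * weight s).
  by apply: eq_tot => c; have /and5P[/eqP h _ _ _ _] := H c.
have e2 : tot hits0 = tot (fun s => (weight s == 2) + 3 * (s == side0) + mixed s * hits0 s).
  by apply: eq_tot => c; have /and5P[_ /eqP h _ _ _] := H c.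
have e3 : tot (fun s => 4 * mixed s + huge s) <= tot (fun s => mixed s * weight s + missing s).
  by apply: leq_sum => c _; have /and5P[_ _ h _ _] := H c.
have e4 : tot (fun s => mixed s * hits0 s) <=
    tot (fun s => mixed s + 2 * leaning s + 6 * (missing s + huge s)).
  by apply: leq_sum => c _; have /and5P[_ _ _ h _] := H c.
have e5 : tot (fun s => mixed s + 2 * leaning s) <=
    tot (fun s => mixed s * hits0 s + 6 * (missing s + huge s)).
  by apply: leq_sum => c _; have /and5P[_ _ _ _ h] := H c.
have r3 : tot hits0 = 3 * q.
  by rewrite /hits0 (totD M (fun s => has_row s 0 + has_row s 1)) totD !(tot_row MP) //; lia.
rewrite (totD M (fun s => 2 * (weight s == 2) + 3 * (s == side0) + 3 * (s == side1))) in e1.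
rewrite (totD M (fun s => 2 * (weight s == 2) + 3 * (s == side0))) in e1.
rewrite (totD M (fun s => 2 * (weight s == 2))) !totMl in e1.
rewrite (totD M (fun s => (weight s == 2) + 3 * (s == side0))) in e2.
rewrite (totD M (fun s => weight s == 2 : nat)) totMl in e2.
rewrite (totD M (fun s => 4 * mixed s)) (totD M (fun s => mixed s * weight s)) totMl in e3.
rewrite (totD M (fun s => mixed s + 2 * leaning s)) (totD M (fun s => mixed s : nat)) in e4.
rewrite !totMl (totD M missing) in e4.
rewrite (totD M (fun s => mixed s : nat)) (totD M (fun s => mixed s * hits0 s)) in e5.
rewrite !totMl (totD M missing) in e5.
by rewrite m2 /= in two mixE; lia.
Qed.

Lemma k33_absurd : m \in k33_mults -> False.
Proof.
move=> mk; have cert := allP k33_certified _ mk.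
have C1 := cert_bound MP q16 kq mP tM (x0 := k33_cert m) cert (isT : 0 < 2) erefl.
have C2 := cert_bound MP q16 kq mP tM (x0 := k33_cert m) cert (isT : 1 < 2) erefl.
have [kE /andP[y7 y9] /andP[z7 z9]] := sides_bounds MP q16 kq mP tM.
have wE := outsideE M; have mixE := outside_split MP q16 kq mP tM.
have J := used_columns_ge7 MP q16 kq mP tM.
have cost := k33_cost MP q16 kq mP tM mk.
have pos : all (fun e => 0 < weigh m (edge_rows e)) k33_edges.
  exact: (allP (_ : all (fun m => all (fun e => 0 < weigh m (edge_rows e)) k33_edges)
    k33_mults) _ mk).
have av e : e \in k33_edges -> tot (covered e) + (8 - avoided e) = 3.
  by move=> eK; have [] := covered_avoided eK (allP pos _ eK); lia.
have a03 := av (0, 3) isT; have a04 := av (0, 4) isT; have a05 := av (0, 5) isT.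
have a13 := av (1, 3) isT; have a14 := av (1, 4) isT; have a15 := av (1, 5) isT.
have a23 := av (2, 3) isT; have a24 := av (2, 4) isT; have a25 := av (2, 5) isT.
rewrite /= in cost; clear av.
case: (eqVneq m (nseq 9 2)) => [m2|m2].
  (* Two colours on every edge give 8 two-cell colours disjoint from any edge, so nothing can be
     wasted. *)
  have d8 e : e \in k33_edges -> 8 - avoided e = 0.
    move=> eK; have := disj_mult_avoided e; rewrite m2 (_ : disj_mult _ _ = 8); first by lia.
    apply/eqP.
    exact: (allP (_ : all (fun e => disj_mult (nseq 9 2) (edge_rows e) == 8) k33_edges) _ eK).
  rewrite !d8 // in a03 a04 a05 a13 a14 a15 a23 a24 a25.
  have s18 : sumn m = 18 by rewrite m2.
  case: (boolP ((y == 9) || (z == 9))) => yz9; last first.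
    by case/norP: yz9 => ny nz; apply: balanced_absurd => //; lia.
  have {}J : q <= used_columns M + 9 by apply: J => //; lia.
  move: C1; rewrite m2 /= !d8 // => C1; eval_weigh C1; clear d8; lia.
have {m2} : m \in behead k33_mults by move: mk; rewrite inE (negbTE m2).
move: C1 C2 mixE => {cert pos mk}.
(* By [cost] at most 21 colours lie outside the sides, and 21 only without waste, contrary to
   [single_cert]. *)
rewrite !inE => + + + mc; have [w21|w20] := leqP 21 (tot outside).
  by case/or4P: mc => [/eqP->|/eqP->|/eqP->|/or4P[]/eqP->] /= _ C2 _;
    eval_weigh C2; abstract_slack; lia.
(* At least 17 colours now lie on the sides, so one side has nine. This forces at least 7 used
   columns, more than [k33_cert] permits. *)
have yz9 : (y == 9) || (z == 9) by move: q16 kE wE w20 y9 z9; clear; lia.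
have {J} : tot mixed <= 5 -> q <= used_columns M + 9 by move=> mix5; apply: J.
by case/or4P: mc => [/eqP->|/eqP->|/eqP->|/or4P[]/eqP->] /= J C1 _ mixE;
  eval_weigh C1; abstract_slack; lia.
Qed.

End K33.

Section K33Minus.
Variables (q k : nat) (M : nat -> 'I_q -> 'I_k) (m : seq nat).
Hypothesis MP : achromatic_matrix M.
Hypotheses (q16 : 16 <= q) (kq : 2 * q + 5 <= k).
Hypotheses (mP : m \in all_mults) (tM : table M = k33_table m).

Local Notation tot := (total M).
Local Notation rows := (rows M).
Local Notation y := (tot (fun s => s == side0)).
Local Notation z := (tot (fun s => s == side1)).
Local Notation avoided e := (tot (disj (edge_rows e))).

(** For [sumn m = 16] this starts a bootstrap: six used columns force waste, the waste leaves at
    most 19 colours outside the sides, and then seven columns are used, which is too many. *)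
Lemma two_cells_le_used : 2 * sumn m <= 6 * used_columns M.
Proof.
rewrite -(two_cell_total mP tM) -totMl /used_columns big_distrr.
apply: (@leq_trans (\sum_(j < q) \sum_(i < 6) (weight (rows (M i j)) == 2))); last first.
  apply: leq_sum => j _ /=; case: (boolP (used M j)) => [_|/hasPn nu].
    apply: (@leq_trans (\sum_(i < 6) 1)); last by rewrite sum1_card card_ord.
    by apply: leq_sum => i _; case: (_ == 2).
  rewrite big1 // => i _; apply/eqP; rewrite eqb0; apply: nu.
  by rewrite mem_iota ltn_ord.
rewrite exchange_big /=.
under eq_bigr => i _ do rewrite (row_sum MP (fun c => weight (rows c) == 2 : nat) (ltn_ord i)).
rewrite exchange_big; apply: leq_sum => c _; rewrite -big_distrl /= -weightE ?size_rows //.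
by case: (weight _ =P 2) => [->|]; rewrite ?muln0.
Qed.

Lemma k33_minus_absurd : m \in k33_minus_mults -> False.
Proof.
move=> mk; have cert := allP k33_minus_certified _ mk.
have C1 := cert_bound MP q16 kq mP tM (x0 := k33_cert m) cert (n := 0).
have C2 := cert_bound MP q16 kq mP tM (x0 := k33_cert m) cert (n := 1).
have [kE /andP[y7 y9] /andP[z7 z9]] := sides_bounds MP q16 kq mP tM.
have wE := outsideE M; have mixE := outside_split MP q16 kq mP tM.
have J := used_columns_ge7 MP q16 kq mP tM.
have J6 := two_cells_le_used.
have cost := k33_minus_cost MP q16 kq mP tM mk.
have outer := tot_weigh mP tM [:: 0; 0; 1; 0; 0; 1; 1; 1] (fun=> 1).
rewrite (eq_tot (g2 := weigh [:: 0; 0; 1; 0; 0; 1; 1; 1])) in outer => [|c]; last first.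
  by rewrite muln1.
have pos : all (fun e => 0 < weigh m (edge_rows e)) (take 8 k33_edges).
  exact: (allP (_ : all (fun m => all (fun e => 0 < weigh m (edge_rows e))
    (take 8 k33_edges)) k33_minus_mults) _ mk).
have av e : e \in take 8 k33_edges -> tot (covered e) + (8 - avoided e) = 3.
  move=> eK; have := covered_avoided MP q16 kq mP tM (mem_take eK) (allP pos _ eK).
  by case; lia.
have a03 := av (0, 3) isT; have a04 := av (0, 4) isT; have a05 := av (0, 5) isT.
have a13 := av (1, 3) isT; have a14 := av (1, 4) isT; have a15 := av (1, 5) isT.
have a23 := av (2, 3) isT; have a24 := av (2, 4) isT.
rewrite /= in cost.
move: mk C1 C2 mixE outer J6 => {cert pos av}; rewrite !inE => /or3P[]/eqP->.
- move=> /(_ _ isT erefl) /= C1 _ mixE outer J6; eval_weigh C1; eval_weigh outer;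
    abstract_slack.
  have {}J : tot outside <= 19 -> q <= used_columns M + 9 by move=> ?; apply: J; lia.
  by lia.
- move=> /(_ _ isT erefl) /= C1 /(_ _ isT erefl) /= C2 mixE outer _.
  eval_weigh C1; eval_weigh C2; eval_weigh outer;
    abstract_slack.
  have {}J : tot outside <= 20 -> q <= used_columns M + 9 by move=> ?; apply: J; lia.
  by lia.
move=> /(_ _ isT erefl) /= C1 /(_ _ isT erefl) /= C2 mixE outer _.
eval_weigh C1; eval_weigh C2; eval_weigh outer; abstract_slack.
have {}J : tot outside <= 20 -> q <= used_columns M + 9 by move=> ?; apply: J; lia.
by lia.
Qed.

End K33Minus.

Lemma no_achromatic_matrix q k (M : nat -> 'I_q -> 'I_k) :
  achromatic_matrix M -> 16 <= q -> k <= 2 * q + 4.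
Proof.
move=> MP q16; rewrite leqNgt; apply/negP => kq.
have {}kq : 2 * q + 5 <= k by lia.
have [M' M'P [m mP tM]] := canonical_form MP q16 kq.
have := mP; rewrite mem_cat => /orP[mk|mk].
  exact: k33_absurd M'P q16 kq mP tM mk.
exact: k33_minus_absurd M'P q16 kq mP tM mk.
Qed.

(** * Colourings with 2q + 4 colours *)

Definition achromatic_fun (q k : nat) (F : nat -> nat -> nat) : Prop :=
  [/\ forall i j, i < 6 -> j < q -> F i j < k,
      forall i j j', i < 6 -> j < q -> j' < q -> F i j = F i j' -> j = j',
      forall i i' j, i < 6 -> i' < 6 -> j < q -> F i j = F i' j -> i = i' &
      forall c c', c < k -> c' < k -> c != c' -> exists i i' j j',
        [/\ i < 6 /\ i' < 6, j < q /\ j' < q, F i j = c, F i' j' = c' &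
            i = i' \/ j = j']].

Lemma achromatic_fun_colourable q k F : 1 < k -> achromatic_fun q k F ->
  achromatic_colourable (cart_prod (complete_graph 6) (complete_graph q)) k.
Proof.
move=> k1 [Fk inj1 inj2 cov].
pose f := [ffun u : 'I_6 * 'I_q => Ordinal (Fk _ _ (ltn_ord u.1) (ltn_ord u.2))].
have fE u : f u = F u.1 u.2 :> nat by rewrite ffunE.
have cellP (i i' j j' : nat) (i6 : i < 6) (i'6 : i' < 6) (jq : j < q) (j'q : j' < q) :
    F i j != F i' j' -> i = i' \/ j = j' ->
    adj (s := cart_prod (complete_graph 6) (complete_graph q))
      (Ordinal i6, Ordinal jq) (Ordinal i'6, Ordinal j'q).
  move=> nF h; rewrite cart_prod_completeE /= -!val_eqE /=.
  case: (eqVneq i i') => [ii|ni]; case: (eqVneq j j') => [jj|nj] //=.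
    by move: nF; rewrite ii jj eqxx.
  by case: h => /eqP; rewrite ?(negbTE ni) ?(negbTE nj).
apply/existsP; exists f; apply/and3P; split.
- apply/forallP => u; apply/forallP => v; apply/implyP.
  rewrite cart_prod_completeE; case: u v => [i j] [i' j'] /=.
  apply: contraTneq => /(congr1 (@nat_of_ord k)); rewrite !fE /=.
  case: (eqVneq i i') => [<-|ni].
    by move/(inj1 _ _ _ (ltn_ord i) (ltn_ord j) (ltn_ord j'))/val_inj ->; rewrite eqxx.
  case: (eqVneq j j') => // <-.
  move/(inj2 _ _ _ (ltn_ord i) (ltn_ord i') (ltn_ord j))/val_inj.
  by move=> e; rewrite e eqxx in ni.
- apply/forallP => c; apply/forallP => c'; apply/implyP => cc'.
  have [i [i' [j [j' [[i6 i'6] [jq j'q] Fc Fc' h]]]]] := cov c c' (ltn_ord c) (ltn_ord c') cc'.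
  apply/existsP; exists (Ordinal i6, Ordinal jq); apply/existsP.
  exists (Ordinal i'6, Ordinal j'q); rewrite cellP ?Fc ?Fc' //=.
  by rewrite -!val_eqE /= !fE /= Fc Fc' !eqxx.
apply/forallP => c; have [c' cc'] : exists c' : 'I_k, c != c' :> nat.
  have k0 : 0 < k by lia.
  case: (eqVneq c (Ordinal k0)) => [->|?]; last by exists (Ordinal k0).
  by exists (Ordinal k1).
have [i [_ [j [_ [[i6 _] [jq _] Fc _ _]]]]] := cov c c' (ltn_ord c) (ltn_ord c') cc'.
by apply/existsP; exists (Ordinal i6, Ordinal jq); rewrite -val_eqE /= fE /= Fc.
Qed.

Lemma colourable_achromatic_matrix q k :
  achromatic_colourable (cart_prod (complete_graph 6) (complete_graph q)) k ->
  exists M : nat -> 'I_q -> 'I_k, achromatic_matrix M.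
Proof.
case/existsP=> f /and3P[/forallP prop /forallP comp _].
exists (fun i j => f (inord i : 'I_6, j)); split.
- move=> i j j' i6 e; apply/eqP/negPn/negP => nj.
  have /forallP/(_ (inord i : 'I_6, j'))/implyP := prop (inord i : 'I_6, j).
  by rewrite e cart_prod_completeE /= eqxx (negbTE nj) => /(_ isT)/eqP.
- move=> i i' j i6 i'6 e; apply/eqP/negPn/negP => ni.
  have /forallP/(_ (inord i' : 'I_6, j))/implyP := prop (inord i : 'I_6, j).
  rewrite e cart_prod_completeE /= eqxx -val_eqE /= !inordK // (negbTE ni).
  by move=> /(_ isT)/eqP.
move=> c c' cc'; have /forallP/(_ c')/implyP/(_ cc') := comp c.
case/existsP=> -[i j] /existsP[[i' j']]; rewrite cart_prod_completeE /=.
case/and3P=> h /eqP fc /eqP fc'; exists i, i', j, j'; rewrite !inord_val; split=> //.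
by case: (eqVneq i i') h => [->|_]; [left | case: eqP => //; right].
Qed.

(* Twelve colours in the first four columns, four on each of the row pairs
   {0,1}, {2,3}, {4,5}.  All other colours have one cell in each of these pairs,
   hence share a row with each of the twelve. *)
Definition base_rows : seq (seq nat) :=
  [:: [:: 0; 1; 2; 3]; [:: 1; 0; 3; 2]; [:: 4; 5; 6; 7]; [:: 6; 7; 4; 5];
      [:: 8; 9; 10; 11]; [:: 11; 10; 9; 8]].
Definition base_cell (i j : nat) : nat := nth 0 (nth [::] base_rows i) j.

(* For even [q]: four kinds of colours, each pair of kinds sharing a row. *)
Definition kind (i : nat) (s : bool) : nat :=
  nth 0 (nth [::] [:: [:: 0; 1]; [:: 3; 2]; [:: 2; 0]; [:: 3; 1]; [:: 1; 2]; [:: 0; 3]] i) s.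
Definition shift (i : nat) (s : bool) : nat :=
  nth 0 (nth [::] [:: [:: 0; 0]; [:: 0; 0]; [:: 0; 0]; [:: 1; 1]; [:: 0; 1]; [:: 1; 0]] i) s.

(** The columns from the fifth on form two blocks of [h], and in each block a row runs through all
    colours of one kind. The six rows realise the six pairs of kinds; the shifts separate equal
    kinds within a block. *)
Definition even_cell (h i j : nat) : nat :=
  if j < 4 then base_cell i j else
  let s := h <= j - 4 in
  12 + kind i s * h + (j - 4 - s * h + shift i s) %% h.

Lemma base_check :
  [&& all (fun i => all (fun j => base_cell i j < 12) (iota 0 4)) (iota 0 6),
      all (fun i => uniq [seq base_cell i j | j <- iota 0 4]) (iota 0 6),
      all (fun j => uniq [seq base_cell i j | i <- iota 0 6]) (iota 0 4) &
      all (fun c => all (fun c' => (c != c') ==>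
        has (fun i => has (fun i' => has (fun j => has (fun j' =>
          [&& base_cell i j == c, base_cell i' j' == c' & (i == i') || (j == j')])
        (iota 0 4)) (iota 0 4)) (iota 0 6)) (iota 0 6)) (iota 0 12)) (iota 0 12)].
Proof. by vm_compute. Qed.

Lemma kind_check :
  [&& all (fun i => (kind i false != kind i true) && all (fun s =>
        (kind i s < 4) && (shift i s < 2)) [:: false; true]) (iota 0 6),
      all (fun s => uniq [seq (kind i s, shift i s) | i <- iota 0 6]) [:: false; true],
      all (fun c => all (fun t => has (fun i => has (fun j => base_cell i j == c) (iota 0 4) &&
        has (fun s => kind i s == t) [:: false; true]) (iota 0 6)) (iota 0 4)) (iota 0 12) &
      all (fun t => all (fun t' => has (fun i => has (fun s => kind i s == t) [:: false; true] &&
        has (fun s => kind i s == t') [:: false; true]) (iota 0 6)) (iota 0 4)) (iota 0 4)].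
Proof. by vm_compute. Qed.

Section Even.
Variable h : nat.
Hypothesis h2 : 2 <= h.
Let q := 2 * h + 4.
Let k := 4 * h + 12.

Let digits a b c d : b < h -> d < h -> a * h + b = c * h + d -> a = c /\ b = d.
Proof.
move=> bh dh e; have h0 : 0 < h by lia.
have := congr1 (divn^~ h) e; have := congr1 (modn^~ h) e.
by rewrite /= !modnMDl !divnMDl // !modn_small // !divn_small // !addn0.
Qed.

Let shift_inj a b n : a < h -> b < h -> (a + n) %% h = (b + n) %% h -> a = b.
Proof. by move=> ah bh /eqP; rewrite eqn_modDr !modn_small // => /eqP. Qed.

Let even_base i j : j < 4 -> even_cell h i j = base_cell i j.
Proof. by rewrite /even_cell => ->. Qed.

Let even_high i (s : bool) t : t < h ->
  even_cell h i (4 + s * h + t) = 12 + kind i s * h + (t + shift i s) %% h.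
Proof.
move=> th; rewrite /even_cell.
have -> : (4 + s * h + t < 4) = false by lia.
have -> : (h <= 4 + s * h + t - 4) = s by case: s; lia.
by congr (_ + (_ + _) %% _); lia.
Qed.

Let highP j : j < q -> 4 <= j -> exists (s : bool) t, t < h /\ j = 4 + s * h + t.
Proof.
move=> jq j4; case: (leqP h (j - 4)) => hj; [exists true, (j - 4 - h)|exists false, (j - 4)];
  rewrite /q in jq; lia.
Qed.

Let low_lt i j : i < 6 -> j < 4 -> base_cell i j < 12.
Proof.
move=> i6 j4; have /and4P[/allP b _ _ _] := base_check.
have := b i; rewrite mem_iota => /(_ i6)/allP/(_ j).
by rewrite mem_iota => /(_ j4).
Qed.

Let kind_lt i s : i < 6 -> kind i s < 4 /\ shift i s < 2.
Proof.
move=> i6; have /and4P[/allP b _ _ _] := kind_check.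
have := b i; rewrite mem_iota => /(_ i6)/andP[_ /allP/(_ s)].
by case: s => /(_ isT)/andP[].
Qed.

Let hit i (s : bool) r : i < 6 -> r < h ->
  exists2 j, j < q & even_cell h i j = 12 + kind i s * h + r.
Proof.
move=> i6 rh; have [_ sh] := kind_lt s i6; have h0 : 0 < h by lia.
have t_lt : (r + (h - shift i s)) %% h < h by rewrite ltn_mod.
(* The column that undoes the cyclic shift; adding [h - shift i s] avoids a truncated
   subtraction. *)
exists (4 + s * h + (r + (h - shift i s)) %% h).
  by rewrite /q; case: s t_lt {sh} => /=; lia.
rewrite even_high //; congr (_ + _); rewrite modnDml -addnA subnK; last by lia.
by rewrite modnDr modn_small.
Qed.

Lemma even_achromatic : achromatic_fun (2 * h + 4) (4 * h + 12) (even_cell h).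
Proof.
have h0 : 0 < h by lia.
have /and4P[_ /allP b1 /allP b2 /allP b3] := base_check.
have /and4P[/allP k0 /allP k1 /allP k2 /allP k3] := kind_check.
have split_j j : j < q -> j < 4 \/ exists (s : bool) t, t < h /\ j = 4 + s * h + t.
  by move=> jq; case: (ltnP j 4) => [|/(highP jq)]; [left | right].
have high_ge i (s : bool) t : t < h -> 12 <= even_cell h i (4 + s * h + t).
  by move=> th; rewrite even_high //; lia.
split.
- move=> i j i6 /split_j[j4|[s [t [th ->]]]].
    by rewrite even_base //; have := low_lt i6 j4; lia.
  rewrite even_high //; have [kd _] := kind_lt s i6.
  have := ltn_pmod (t + shift i s) h0; move: kd.
  by case: (kind i s) => [|[|[|[|]]]] //; lia.
- move=> i j j' i6 /split_j[j4|[s [t [th ->]]]] /split_j[j'4|[s' [t' [t'h ->]]]].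
  + rewrite !even_base // => e; have := b1 i; rewrite mem_iota => /(_ i6) u.
    have e' : nth 0 [seq base_cell i j | j <- iota 0 4] j =
              nth 0 [seq base_cell i j | j <- iota 0 4] j'.
      by rewrite !(nth_map 0) ?size_iota // !nth_iota.
    by apply/eqP; rewrite -(nth_uniq 0 _ _ u) ?size_map ?size_iota // e' eqxx.
  + by have := low_lt i6 j4; rewrite even_base // => + e; have := high_ge i s' t' t'h; lia.
  + by have := low_lt i6 j'4; rewrite [RHS]even_base // => + e; have := high_ge i s t th; lia.
  rewrite !even_high // -!addnA => /addnI/digits[]; rewrite ?ltn_mod // => ek.
  have -> : s = s'.
    have := k0 i; rewrite mem_iota => /(_ i6)/andP[nk _].
    by case: s s' ek => -[] // ek; rewrite ek eqxx in nk.
  by move/shift_inj => -> //.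
- move=> i i' j i6 i'6 /split_j[j4|[s [t [th ->]]]].
    rewrite !even_base // => e; have := b2 j; rewrite mem_iota => /(_ j4) u.
    have e' : nth 0 [seq base_cell i j | i <- iota 0 6] i =
              nth 0 [seq base_cell i j | i <- iota 0 6] i'.
      by rewrite !(nth_map 0) ?size_iota // !nth_iota.
    by apply/eqP; rewrite -(nth_uniq 0 _ _ u) ?size_map ?size_iota // e' eqxx.
  rewrite !even_high // -!addnA => /addnI/digits[]; rewrite ?ltn_mod // => ek.
  rewrite ![t + _]addnC => /shift_inj es.
  have {}es : shift i s = shift i' s.
    by apply: es; [have [] := kind_lt s i6 | have [] := kind_lt s i'6]; lia.
  have u := k1 s; have {}u : uniq [seq (kind i s, shift i s) | i <- iota 0 6].
    by apply: u; case: s {ek es}.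
  apply/eqP; rewrite -(nth_uniq (0, 0) _ _ u) ?size_map ?size_iota //.
  by rewrite !(nth_map 0) ?size_iota // !nth_iota // ek es.
have high_col c : c < k -> 12 <= c -> exists t r, [/\ t < 4, r < h & c = 12 + t * h + r].
  move=> ck c12; exists ((c - 12) %/ h), ((c - 12) %% h); split.
  - by rewrite ltn_divLR //; rewrite /k in ck; lia.
  - by rewrite ltn_mod.
  by rewrite -addnA -divn_eq; lia.
have mixed_cov c t r : c < 12 -> t < 4 -> r < h -> exists i j j',
    [/\ i < 6, j < q, j' < q, even_cell h i j = c & even_cell h i j' = 12 + t * h + r].
  move=> c12 t4 rh; have := k2 c; rewrite mem_iota => /(_ c12)/allP/(_ t).
  rewrite mem_iota => /(_ t4)/hasP[i]; rewrite mem_iota => i6 /andP[/hasP[j]].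
  rewrite mem_iota => j4 /eqP bc /hasP[s _ /eqP ks].
  have [j' j'q e] := hit s i6 rh; exists i, j, j'; rewrite even_base // e ks.
  by split => //; rewrite /q; lia.
move=> c c' ck c'k cc'.
case: (ltnP c 12) => c12; case: (ltnP c' 12) => c'12.
- have := b3 c; rewrite mem_iota => /(_ c12)/allP/(_ c'); rewrite mem_iota => /(_ c'12).
  rewrite cc' => /hasP[i]; rewrite mem_iota => i6 /hasP[i']; rewrite mem_iota => i'6.
  case/hasP=> j; rewrite mem_iota => j4 /hasP[j']; rewrite mem_iota => j'4.
  case/and3P=> /eqP e /eqP e' ij; exists i, i', j, j'; rewrite !even_base //; split=> //.
    by split; lia.
  by case/orP: ij => /eqP; [left | right].
- have [t [r [t4 rh ->]]] := high_col c' c'k c'12.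
  have [i [j [j' [i6 jq j'q e e']]]] := mixed_cov c t r c12 t4 rh.
  by exists i, i, j, j'; split=> //; left.
- have [t [r [t4 rh ->]]] := high_col c ck c12.
  have [i [j [j' [i6 jq j'q e e']]]] := mixed_cov c' t r c'12 t4 rh.
  by exists i, i, j', j; split=> //; left.
have [t [r [t4 rh ->]]] := high_col c ck c12.
have [t' [r' [t'4 r'h ->]]] := high_col c' c'k c'12.
have := k3 t; rewrite mem_iota => /(_ t4)/allP/(_ t'); rewrite mem_iota => /(_ t'4).
case/hasP=> i; rewrite mem_iota => i6 /andP[/hasP[s _ /eqP ks] /hasP[s' _ /eqP ks']].
have [j jq e] := hit s i6 rh; have [j' j'q e'] := hit s' i6 r'h.
by exists i, i, j, j'; split; rewrite ?e ?e' ?ks ?ks' //; left.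
Qed.

End Even.

(* For odd [q]: up to four blocks of [b <= 9] columns, each with [b] colours on a
   set T of three rows and [b] colours on the complement of T.  The residues
   [r - 3 r'] with [r, r' < 3] cover Z/b, so any two of them meet in a column. *)
Definition in_side (n i : nat) : bool :=
  i \in nth [::] [:: [:: 0; 2; 4]; [:: 0; 2; 5]; [:: 0; 3; 4]; [:: 1; 2; 4]] n.

(** Here [i./2] is the index of the row pair and plays the role of [r] or [r']. Each of the [off]
    earlier columns accounts for two colours. *)
Fixpoint block_row (i n off : nat) (bs : seq nat) : seq nat :=
  if bs is b :: bs' then
    [seq 12 + 2 * off + (if in_side n i then 0 else b) +
         (t + (if in_side n i then 1 else 3) * i./2) %% b | t <- iota 0 b] ++
    block_row i n.+1 (off + b) bs'
  else [::].

Definition block_rows (bs : seq nat) : seq (seq nat) :=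
  [seq nth [::] base_rows i ++ block_row i 0 0 bs | i <- iota 0 6].

Definition cells (rs : seq (seq nat)) (c : nat) : seq (nat * nat) :=
  [seq (i, index c (nth [::] rs i)) | i <- iota 0 6 & c \in nth [::] rs i].

Definition meets (s t : seq (nat * nat)) : bool :=
  lazy_has (fun x => lazy_has (fun y => if x.1 == y.1 then true else x.2 == y.2) t) s.

Fixpoint pairwise_meets (l : seq (seq (nat * nat))) : bool :=
  if l is s :: l' then all (meets s) l' && pairwise_meets l' else true.

Definition achromatic_rows (q k : nat) (rs : seq (seq nat)) : bool :=
  [&& all (fun i => let r := nth [::] rs i in
             [&& size r == q, uniq r & all (fun c => c < k) r]) (iota 0 6),
      all (fun j => uniq [seq nth 0 (nth [::] rs i) j | i <- iota 0 6]) (iota 0 q) &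
      pairwise_meets [seq cells rs c | c <- iota 0 k]].

Lemma pairwise_meetsP l i j : pairwise_meets l -> i < j < size l ->
  meets (nth [::] l i) (nth [::] l j).
Proof.
elim: l i j => [|s l IHl] i j; first by rewrite ltn0 andbF.
case: i j => [|i] [|j] //= /andP[/allP h hl].
  by move=> jl; apply/h/mem_nth.
exact: IHl.
Qed.

Lemma achromatic_rowsP q k rs : achromatic_rows q k rs ->
  achromatic_fun q k (fun i j => nth 0 (nth [::] rs i) j).
Proof.
case/and3P=> /allP hr /allP hc hm.
have row i : i < 6 -> [/\ size (nth [::] rs i) = q, uniq (nth [::] rs i) &
    all (fun c => c < k) (nth [::] rs i)].
  by move=> i6; have := hr i; rewrite mem_iota => /(_ i6)/and3P[/eqP].
split.
- move=> i j i6 jq; have [sz _ /allP h] := row i i6; by apply/h/mem_nth; rewrite sz.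
- move=> i j j' i6 jq j'q /eqP; have [sz u _] := row i i6.
  by rewrite nth_uniq ?sz // => /eqP.
- move=> i i' j i6 i'6 jq e; have := hc j; rewrite mem_iota => /(_ jq) u.
  apply/eqP; rewrite -(nth_uniq 0 _ _ u) ?size_map ?size_iota //.
  by rewrite !(nth_map 0) ?size_iota // !nth_iota // e.
have meetP c c' : meets (cells rs c) (cells rs c') -> exists i i' j j',
    [/\ i < 6 /\ i' < 6, j < q /\ j' < q, nth 0 (nth [::] rs i) j = c,
        nth 0 (nth [::] rs i') j' = c' & i = i' \/ j = j'].
  rewrite /meets lazy_hasE => /hasP[x /mapP[i]]; rewrite mem_filter mem_iota => /andP[ci i6] ->.
  rewrite lazy_hasE => /hasP[x' /mapP[i']]; rewrite mem_filter mem_iota => /andP[ci' i'6] -> h.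
  exists i, i', (index c (nth [::] rs i)), (index c' (nth [::] rs i')).
  have [sz _ _] := row i i6; have [sz' _ _] := row i' i'6.
  rewrite !nth_index //; split=> //; first by rewrite -{1}sz -sz' !index_mem.
  by move: h => /=; case: (eqVneq i i') => [|_ /eqP]; [left | right].
move=> c c' ck c'k; rewrite neq_ltn => /orP[lt|lt].
  apply: meetP; have := @pairwise_meetsP _ c c' hm; rewrite size_map size_iota lt c'k.
  by rewrite !(nth_map 0) ?size_iota // !nth_iota //; apply.
have [|i [i' [j [j' [[i6 i'6] [jq j'q] e e' h]]]]] := meetP c' c.
  have := @pairwise_meetsP _ c' c hm; rewrite size_map size_iota lt ck.
  by rewrite !(nth_map 0) ?size_iota // !nth_iota //; apply.
by exists i', i, j', j; split=> //; case: h; [left | right].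
Qed.

(** The sums are [q - 4] for [q = 17, 19, ..., 39]. Block sizes 3 and 6 do not occur, since the
    shifts 0, 3, 6 must be distinct modulo the size. *)
Definition odd_blocks : seq (seq nat) :=
  [:: [:: 9; 4]; [:: 8; 7]; [:: 9; 8]; [:: 9; 5; 5]; [:: 9; 8; 4]; [:: 9; 9; 5];
      [:: 9; 9; 7]; [:: 9; 9; 9]; [:: 9; 8; 8; 4]; [:: 9; 9; 9; 4]; [:: 9; 8; 8; 8];
      [:: 9; 9; 9; 8]].

(** Colours of different blocks share a row: any two of the four sets agree on one of the row pairs
    and differ on another, so each meets the other and its complement. *)
Lemma odd_check : all (fun bs => let q := sumn bs + 4 in
  achromatic_rows q (2 * q + 4) (block_rows bs)) odd_blocks.
Proof. by vm_compute. Qed.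

Lemma colourable_2q4 q : (42 <= q /\ ~~ odd q) \/ (16 <= q /\ q <= 40) ->
  achromatic_colourable (cart_prod (complete_graph 6) (complete_graph q)) (2 * q + 4).
Proof.
move=> hq; case: (boolP (odd q)) => oq.
  have [bs bsP qE] : exists2 bs, bs \in odd_blocks & q = sumn bs + 4.
    case: hq => [[_ /negP//]|[q16 q40]].
    exists (nth [::] odd_blocks (q - 17)./2).
      by apply: mem_nth; rewrite /=; lia.
    have n12 : (q - 17)./2 \in iota 0 12 by rewrite mem_iota; lia.
    rewrite -(eqP (allP (_ : all (fun n => n.*2 + 17 == sumn (nth [::] odd_blocks n) + 4)
      (iota 0 12)) _ n12)) //; lia.
  apply: achromatic_fun_colourable; first by lia.
  rewrite qE; apply: achromatic_rowsP; exact: (allP odd_check _ bsP).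
have [h h2 qE] : exists2 h, 2 <= h & q = 2 * h + 4 by exists (q - 4)./2; lia.
rewrite qE (_ : 2 * (2 * h + 4) + 4 = 4 * h + 12); last by lia.
by apply: achromatic_fun_colourable (even_achromatic h2); lia.
Qed.

Theorem theorem15 (q : nat)
    (hq : (42 <= q /\ ~~ odd q) \/ (16 <= q /\ q <= 40)) :
  achr (cart_prod (complete_graph 6) (complete_graph q)) = 2 * q + 4.
Proof.
apply/eqP; rewrite eqn_leq (achr_ge (colourable_2q4 hq)) andbT.
apply/bigmax_leqP => -[k kq] /= /colourable_achromatic_matrix[M MP].
by apply: no_achromatic_matrix MP _; lia.
Qed.
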